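(* Let $\Gamma=\Gamma(S_{d_0},HF)$ be a finitely generated saturated directed group acting on $T_{\bar d}$ with $\bar d$ bounded and $F$ a nontrivial finite group, and let $Y_n$ be the random walk with step law $\mu$ (below) started at the identity. Then for every $\varepsilon>0$ and all $n$ large enough, $$\beta'(n)-\varepsilon\le\frac{\log\left(-\log P(Y_n=1)\right)}{\log n}\le\beta(n)+\varepsilon.$$
   Context: $\bar d=(d_j)_{j\ge0}$ is a bounded sequence of integers $d_j\ge2$, $\sigma\bar d=(d_1,d_2,\dots)$. $T_{\bar d}$ is the spherically homogeneous rooted tree with vertices the finite sequences $i_1\dots i_k$, $i_j\in\{1,\dots,d_{j-1}\}$; $\partial T_{\bar d}$ its boundary; $1^\infty=111\dots$. Products of automorphisms follow $(gf)(x)=f(g(x))$. Each $g\in\mathrm{Aut}(T_{\bar d})$ is written $g=(g_1,\dots,g_{d_0})\tau$ ($g_t\in\mathrm{Aut}(T_{\sigma\bar d})$, $\tau\in S_{d_0}$, $g(ty)=\tau(t)g_t(y)$); rooted automorphisms form a copy of $S_{d_0}$. $H_{\bar d}$ is defined recursively: $h\in H_{\bar d}$ iff $h=(h',\sigma_2,\dots,\sigma_{d_0})$ with $h'\in H_{\sigma\bar d}$ and $\sigma_2,\dots,\sigma_{d_0}$ rooted automorphisms of $T_{\sigma\bar d}$; thus $H_{\bar d}\cong\prod_{l\ge1}S_{d_l}^{\,d_{l-1}-1}$. For a finite group $F$, $F\wr_{\partial T_{\bar d}}\mathrm{Aut}(T_{\bar d})=\{\varphi:\partial T_{\bar d}\to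 F\}\rtimes\mathrm{Aut}(T_{\bar d})$ with $(g.\varphi)(x)=\varphi(g(x))$ and $(\varphi g)(\varphi'g')=\varphi(g.\varphi')gg'$; $\varphi_f$ equals $f$ at $1^\infty$ and is trivial elsewhere. $\Gamma(S_{d_0},HF)$ is the subgroup generated by the rooted group $S_{d_0}$, a finite subgroup $H\le H_{\bar d}$ such that the pushforward of the uniform measure on $H$ to each factor $S_{d_l}$ is uniform, and $\{\varphi_f:f\in F\}$; $HF\cong H\times F$. $\mu$ is the law of $sks'$ with $s,s'$ uniform on $S_{d_0}$, $k$ uniform on $HF$, independent. $p_i=\frac{d_i-1}{d_i^2}$, $k(n)=\min\{k\ge0:p_0\cdots p_kn\le1\}$, $\beta(n)=\frac{\log(d_0\cdots d_{k(n)})}{\log n}$; $l(n)=\max\{l:\prod_{i=0}^{l}\frac{d_i^3}{d_i-1}\le n\}$ and $\beta'(n)=\frac{\log(d_0\cdots d_{l(n)})}{\log n}$. *)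

(* Defs.v *)
From HB Require Import structures.
From mathcomp Require Import all_boot all_fingroup.
From Stdlib Require Import Reals ClassicalEpsilon.

Set Implicit Arguments.
Unset Strict Implicit.
Unset Printing Implicit Defensive.

(* Conventions: labels are 0-based, so the letter i in {1,...,d_j} of the paper
   is the number i-1 < d_j here; in particular 1^infinity is the constant-0
   sequence.  A boundary point of T_d is x : nat -> nat with x j < d j. *)

Definition valid (d : nat -> nat) (x : nat -> nat) : Prop := forall j, x j < d j.

Definition pb (P : Prop) : bool := if excluded_middle_informative P then true else false.

Definition pnat (n : nat) (s : {perm 'I_n}) (i : nat) : nat :=
  match (insub i : option 'I_n) with Some o => val (s o) | None => i end.

(* Elements of H_d = prod_{l>=1} S_{d_l}^{d_{l-1}-1}: h m t (t a letter at level m,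
   t <> 0 in 0-based labels) is the rooted permutation (in S_{d_{m+1}}) applied
   at the vertex 1^m t, i.e. h(1^m t y) = 1^m t (h m t)(y) on the first letter of y. *)
Definition Hel (d : nat -> nat) := forall m : nat, 'I_(d m) -> {perm 'I_(d m.+1)}.

Definition idH (d : nat -> nat) : Hel d := fun m t => 1%g.

(* componentwise product, with the convention (gf)(x) = f(g(x)) (mathcomp permM) *)
Definition mulH (d : nat -> nat) (h1 h2 : Hel d) : Hel d := fun m t => (h1 m t * h2 m t)%g.

Definition happ (d : nat -> nat) (h : Hel d) (k t i : nat) : nat :=
  match (insub t : option 'I_(d k)) with Some o => pnat (h k o) i | None => i end.

Definition act_H (d : nat -> nat) (h : Hel d) (x : nat -> nat) : nat -> nat :=
  fun j => match j with
           | 0 => x 0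
           | k.+1 => if (x k != 0) && all (fun i => x i == 0) (iota 0 k)
                     then happ h k (x k) (x k.+1) else x k.+1
           end.

Definition act_root (d : nat -> nat) (s : {perm 'I_(d 0)}) (x : nat -> nat) : nat -> nat :=
  fun j => if j is 0 then pnat s (x 0) else x j.

(* Elements phi g of F wr_{boundary} Aut(T_d): phi : boundary -> F,
   g given by its action on the boundary. *)
Record WE (F : finGroupType) := mkWE { wphi : (nat -> nat) -> F ; wg : (nat -> nat) -> (nat -> nat) }.

(* (phi g)(phi' g') = phi (g.phi') g g',  (g.phi')(x) = phi'(g x),  (g g')(x) = g'(g x) *)
Definition wmul (F : finGroupType) (a b : WE F) : WE F :=
  mkWE (fun x => (wphi a x * wphi b (wg a x))%g) (fun x => wg b (wg a x)).

Definition wone (F : finGroupType) : WE F := mkWE (fun _ => 1%g) (fun x => x).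

Definition is_one (d : nat -> nat) (F : finGroupType) (a : WE F) : Prop :=
  forall x, valid d x -> (forall j, wg a x j = x j) /\ wphi a x = 1%g.

Definition w_root (d : nat -> nat) (F : finGroupType) (s : {perm 'I_(d 0)}) : WE F :=
  mkWE (fun _ => 1%g) (act_root s).

Definition w_H (d : nat -> nat) (F : finGroupType) (h : Hel d) : WE F :=
  mkWE (fun _ => 1%g) (act_H h).

Definition w_phi (F : finGroupType) (f : F) : WE F :=
  mkWE (fun x => if pb (forall j, x j = 0) then f else 1%g) (fun x => x).

Definition step_elem (d : nat -> nat) (F : finGroupType) (Hs : seq (Hel d))
  (st : ({perm 'I_(d 0)} * 'I_(size Hs) * F * {perm 'I_(d 0)})%type) : WE F :=
  let: (s, i, f, s') := st in
  wmul (wmul (wmul (@w_root d F s) (@w_H d F (nth (@idH d) Hs i))) (w_phi f)) (@w_root d F s').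

Definition wprod (d : nat -> nat) (F : finGroupType) (Hs : seq (Hel d)) (n : nat)
  (w : {ffun 'I_n -> ({perm 'I_(d 0)} * 'I_(size Hs) * F * {perm 'I_(d 0)})%type}) : WE F :=
  foldr (fun i acc => wmul (@step_elem d F Hs (w i)) acc) (@wone F) (enum 'I_n).

(* P(Y_n = 1): the steps are i.i.d. uniform on the finite set of tuples (s,h,f,s'),
   so the return probability is (#words with product 1) / (#tuples)^n. *)
Definition retprob (d : nat -> nat) (F : finGroupType) (Hs : seq (Hel d)) (n : nat) : R :=
  Rdiv (INR #|[set w : {ffun 'I_n -> ({perm 'I_(d 0)} * 'I_(size Hs) * F * {perm 'I_(d 0)})%type}
            | pb (is_one d (@wprod d F Hs n w))]|)
       (INR (#|[set: ({perm 'I_(d 0)} * 'I_(size Hs) * F * {perm 'I_(d 0)})%type]| ^ n)).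

Fixpoint first_from (P : pred nat) (k fuel : nat) : nat :=
  if fuel is f.+1 then (if P k then k else first_from P k.+1 f) else k.

(* p_0 ... p_k n <= 1  with p_i = (d_i - 1)/d_i^2, cleared of denominators *)
Definition kcond (d : nat -> nat) (n k : nat) : bool :=
  n * \prod_(i < k.+1) (d i).-1 <= \prod_(i < k.+1) (d i) ^ 2.

(* k(n) = min { k : p_0...p_k n <= 1 }  (it is attained at some k <= n since p_i <= 1/4) *)
Definition kfun (d : nat -> nat) (n : nat) : nat := first_from (kcond d n) 0 n.+1.

(* prod_{i=0}^l d_i^3/(d_i - 1) <= n, cleared of denominators *)
Definition lcond (d : nat -> nat) (n l : nat) : bool :=
  \prod_(i < l.+1) (d i) ^ 3 <= n * \prod_(i < l.+1) (d i).-1.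

(* l(n) = max { l : lcond d n l }; since the products increase with l the set is an
   initial segment and fails at l = n, so l(n) = (first failure) - 1 (when nonempty). *)
Definition lfun (d : nat -> nat) (n : nat) : nat :=
  (first_from (fun l => ~~ lcond d n l) 0 n.+1).-1.

Definition beta (d : nat -> nat) (n : nat) : R :=
  Rdiv (ln (INR (\prod_(i < (kfun d n).+1) d i))) (ln (INR n)).

Definition beta' (d : nat -> nat) (n : nat) : R :=
  Rdiv (ln (INR (\prod_(i < (lfun d n).+1) d i))) (ln (INR n)).

(* Main.v *)
(** The walk is studied through its action on the boundary, one vertex at a time.  The image
of a vertex v of level m under the successive prefixes of the word is a Markov chain: a
rooted factor refreshes the first letter, and a factor h refreshes the letter that follows
the first letter different from 1.  At each time v therefore contributes to its section
either an element of HF (when its image is 1^m, event b), or a uniform element of S_(d_m)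
(when its image is 1^(m-1) t with t <> 1, event a), or nothing.  An explicit potential,
defined by recursion on the levels, shows that the expected number of alternations from a
to b in time n is p_0 ... p_(m-1) n + O(1), and that v avoids 1^m up to time n with
probability at most 2 (1 - p_0 ... p_(m-1) / 6)^n.

Upper bound for P(Y_n = 1).  The lamps are switched at the preimages of 1^infinity under the
prefixes.  Given the S- and H-parts of the word, the probability that all lamps are off is at
most |F|^(-r), r the number of vertices of level m whose trajectory meets 1^m.  With
m = l(n) + 1 all D = d_0 ... d_(m-1) vertices do so outside an event of probability
exp(-cD), hence P(Y_n = 1) <= exp(-cD).

Lower bound.  With m = k(n) + 1 the reduced words at the D vertices of level m have total
length O(D) with probability at least 1/2, and these words together with the permutation of
level m determine the group element.  So half of the mass of Y_n sits on exp(O(D log D))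
elements, and by symmetry of the law P(Y_2n = 1) is at least the square of the mass of the
heaviest one. *)

Require Import Defs.
From Stdlib Require Import Reals Lra FunctionalExtensionality ClassicalEpsilon.

(* mathcomp-algebra-tactics shadows these two. *)
Ltac rlra := lra.
Ltac rnra := nra.

From HB Require Import structures.
From mathcomp Require Import all_boot all_order all_fingroup all_algebra.
From mathcomp Require Import ring lra zify.
From mathcomp Require Import Rstruct.

Set Implicit Arguments.
Unset Strict Implicit.
Unset Printing Implicit Defensive.
Import Order.TTheory GRing.Theory Num.Theory.

(* prime.v also defines a [pnat]. *)
Local Notation lperm := Defs.pnat.

Section Counting.
Local Open Scope ring_scope.

(** * Averages over finite types and over words *)

Section Averages.
Variable K : realFieldType.

Definition avg (T : finType) (f : T -> K) : K := (\sum_x f x) / #|T|%:R.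

Lemma eq_avg (T : finType) (f g : T -> K) : f =1 g -> avg f = avg g.
Proof. by move=> e; rewrite /avg (eq_bigr g). Qed.

Lemma le_avg (T : finType) (f g : T -> K) :
  (forall x, f x <= g x) -> avg f <= avg g.
Proof.
by move=> le; rewrite /avg ler_wpM2r ?invr_ge0 ?ler0n ?ler_sum.
Qed.

Lemma avg_const (T : finType) (c : K) : (0 < #|T|)%N -> avg (fun _ : T => c) = c.
Proof.
rewrite /avg => T0; rewrite sumr_const -(mulr_natr c) mulfK // pnatr_eq0 -lt0n; exact: T0.
Qed.

Lemma avgD (T : finType) (f g : T -> K) : avg (fun x => f x + g x) = avg f + avg g.
Proof. by rewrite /avg big_split mulrDl. Qed.

Lemma avgZ (T : finType) c (f : T -> K) : avg (fun x => c * f x) = c * avg f.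
Proof. by rewrite /avg -mulr_sumr mulrA. Qed.

Lemma avg_sum (T I : finType) (f : I -> T -> K) :
  avg (fun x => \sum_i f i x) = \sum_i avg (f i).
Proof. by rewrite /avg exchange_big /= mulr_suml. Qed.

Lemma avg_exchange (S T : finType) (f : S -> T -> K) :
  avg (fun x => avg (f x)) = avg (fun y => avg (f^~ y)).
Proof.
rewrite /avg -!mulr_suml exchange_big /= -!mulrA; congr (_ * _); exact: mulrC.
Qed.

Lemma avg_pair (S T : finType) (f : S * T -> K) :
  avg f = avg (fun x => avg (fun y => f (x, y))).
Proof.
rewrite /avg card_prod natrM -mulr_suml -mulrA.
rewrite pair_big /= invfM [X in _ = _ * X]mulrC.
by congr (_ * _); apply: eq_bigr => -[].
Qed.

Lemma avg_bij (T : finType) (h : T -> T) (f : T -> K) :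
  injective h -> avg (fun x => f (h x)) = avg f.
Proof. by move=> hI; rewrite /avg [in RHS](reindex_inj hI). Qed.

(** Composing with a transposition shows that the left side does not depend on [o]. Averaging it
    over all positions and exchanging the averages leaves, for each permutation, a reindexing of
    [g]. *)
Lemma avg_perm (n : nat) (g : 'I_n -> K) (o : 'I_n) :
  avg (fun s : {perm 'I_n} => g (s o)) = avg g.
Proof.
have indep o' : avg (fun s : {perm 'I_n} => g (s o')) = avg (fun s : {perm 'I_n} => g (s o)).
  rewrite -(avg_bij (h := fun s => (tperm o o' * s)%g)); last exact: mulgI.
  by apply: eq_avg => s; rewrite permM tpermR.
have n0 : (0 < #|'I_n|)%N by apply/card_gt0P; exists o.
rewrite -[LHS](avg_const _ n0) -(eq_avg indep) avg_exchange.
rewrite -[RHS](@avg_const {perm 'I_n}); last by apply/card_gt0P; exists 1%g.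
by apply: eq_avg => s; apply: avg_bij; apply: perm_inj.
Qed.

Variable T : finType.

(** Expectation over i.i.d. uniform letters, peeled off at the first letter so that the Markov
    property becomes one induction step; [wavg_ffun] links it to counting. *)
Fixpoint wavg (n : nat) (G : seq T -> K) : K :=
  if n is n'.+1 then avg (fun a => wavg n' (fun l => G (a :: l))) else G [::].

Lemma eq_wavg n G G' : (forall l, size l = n -> G l = G' l) -> wavg n G = wavg n G'.
Proof.
elim: n G G' => [|n IH] G G' e /=; first exact: e.
by apply: eq_avg => a; apply: IH => l sl; apply: e; rewrite /= sl.
Qed.

Lemma le_wavg n G G' : (forall l, size l = n -> G l <= G' l) -> wavg n G <= wavg n G'.
Proof.
elim: n G G' => [|n IH] G G' e /=; first exact: e.
by apply: le_avg => a; apply: IH => l sl; apply: e; rewrite /= sl.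
Qed.

Lemma wavgD n G G' : wavg n (fun l => G l + G' l) = wavg n G + wavg n G'.
Proof.
by elim: n G G' => [//|n IH] G G' /=; rewrite -avgD; apply: eq_avg => a; apply: IH.
Qed.

Lemma wavgZ n c G : wavg n (fun l => c * G l) = c * wavg n G.
Proof.
by elim: n G => [//|n IH] G /=; rewrite -avgZ; apply: eq_avg => a; apply: IH.
Qed.

Lemma wavg_sum n (I : finType) (G : I -> seq T -> K) :
  wavg n (fun l => \sum_i G i l) = \sum_i wavg n (G i).
Proof.
by elim: n G => [//|n IH] G /=; rewrite -avg_sum; apply: eq_avg => a; apply: IH.
Qed.

Lemma wavg_avg n (I : finType) (G : I -> seq T -> K) :
  wavg n (fun l => avg (fun i => G i l)) = avg (fun i => wavg n (G i)).
Proof.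
elim: n G => [//|n IH] G /=; rewrite avg_exchange.
by apply: eq_avg => a; apply: IH.
Qed.

Lemma wavg_cat n n' G :
  wavg (n + n') G = wavg n (fun u => wavg n' (fun v => G (u ++ v))).
Proof. by elim: n G => [//|n IH] G /=; apply: eq_avg => a; apply: IH. Qed.

(** Together with [wavg_map] for the inversion of letters, this gives the symmetry of the law of the
    walk. *)
Lemma wavg_rev n G : wavg n (fun l => G (rev l)) = wavg n G.
Proof.
elim: n G => [//|n IH] G; rewrite -{2}(addn1 n) wavg_cat /= wavg_avg.
apply: eq_avg => a; rewrite -(IH (fun u => G (u ++ [:: a]))).
by apply: eq_wavg => l _; rewrite rev_cons cats1.
Qed.

Lemma wavg_map n (h : T -> T) G : injective h -> wavg n (fun l => G (map h l)) = wavg n G.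
Proof.
move=> hI; elim: n G => [//|n IH] G /=.
rewrite -[RHS](avg_bij _ hI); apply: eq_avg => a.
exact: IH (fun l => G (h a :: l)).
Qed.

Hypothesis T0 : (0 < #|T|)%N.

Lemma wavg_const n c : wavg n (fun _ => c) = c.
Proof. by elim: n => //= n ->; apply: avg_const. Qed.

Lemma wavg_ffun n (G : seq T -> K) :
  wavg n G = (\sum_(w : {ffun 'I_n -> T}) G [seq w i | i <- enum 'I_n]) / (#|T| ^ n)%:R.
Proof.
elim: n G => [|n IH] G /=.
  have f0 : 'I_0 -> T by case.
  rewrite expn0 divr1 (big_pred1 (finfun f0)).
    by rewrite (size0nil (s := enum 'I_0)) // size_enum_ord.
  by move=> w /=; apply/esym/eqP/ffunP => -[].
rewrite /avg expnS natrM invfM mulrA [in RHS]mulrAC; congr (_ / _).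
rewrite (eq_bigr _ (fun a _ => IH _)) -mulr_suml pair_big /=; congr (_ / _).
pose h (p : T * {ffun 'I_n -> T}) : {ffun 'I_n.+1 -> T} :=
  [ffun i => if unlift ord0 i is Some j then p.2 j else p.1].
rewrite (reindex h) /=.
  apply: eq_bigr => -[a w] _; rewrite enum_ordSl /= /h ffunE unlift_none; congr (G (_ :: _)).
  by rewrite -map_comp; apply: eq_map => i /=; rewrite ffunE liftK.
exists (fun w => (w ord0, [ffun i => w (lift ord0 i)])) => [[a w] _|w _].
  rewrite /h ffunE unlift_none; congr pair; apply/ffunP => i.
  by rewrite !ffunE liftK.
by apply/ffunP => i; rewrite ffunE /=; case: unliftP => [j|] -> //; rewrite ffunE.
Qed.

End Averages.

(** * The action on the boundary *)

Lemma pbP (P : Prop) : reflect P (pb P).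
Proof. by rewrite /pb; case: excluded_middle_informative => ?; constructor. Qed.

Lemma eq_pb (P Q : Prop) : (P <-> Q) -> pb P = pb Q.
Proof. by move=> [PQ QP]; apply/pbP/pbP. Qed.

Lemma lperm_ord n (s : {perm 'I_n}) (o : 'I_n) : lperm s o = s o.
Proof. by rewrite /lperm valK. Qed.

Lemma lperm_lt n (s : {perm 'I_n}) i : (i < n)%N -> (lperm s i < n)%N.
Proof. by move=> lt; rewrite (lperm_ord s (Ordinal lt)). Qed.

Lemma lpermM n (s t : {perm 'I_n}) i : lperm (s * t)%g i = lperm t (lperm s i).
Proof.
rewrite /lperm; case: insubP => [o _ _|]; first by rewrite valK permM.
by move=> ni; rewrite insubN.
Qed.

Lemma lperm1 n i : lperm (1 : {perm 'I_n})%g i = i.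
Proof. by rewrite /lperm; case: insubP => // o _ <-; rewrite perm1. Qed.

Definition zeros (k : nat) (x : nat -> nat) : bool := all (fun i => x i == 0%N) (iota 0 k).

Lemma zerosS k x : zeros k.+1 x = zeros k x && (x k == 0%N).
Proof. by rewrite /zeros -addn1 iotaD all_cat /= andbT. Qed.

Lemma zerosP k x : reflect (forall i, (i < k)%N -> x i = 0%N) (zeros k x).
Proof.
apply: (iffP allP) => [z i lt|z i]; first by apply/eqP/z; rewrite mem_iota.
by rewrite mem_iota => lt; apply/eqP/z.
Qed.

Lemma eq_zeros k x y : (forall i, (i < k)%N -> x i = y i) -> zeros k x = zeros k y.
Proof. by move=> e; apply/zerosP/zerosP => z i lt; [rewrite -e|rewrite e] => //; apply: z. Qed.

Definition tailn (m : nat) (x : nat -> nat) : nat -> nat := fun j => x (m + j)%N.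

Lemma zerosD m k x : zeros (m + k) x = zeros m x && zeros k (tailn m x).
Proof.
elim: k => [|k IH]; first by rewrite addn0 andbT.
by rewrite addnS !zerosS IH andbA.
Qed.

Section Actions.
Variable d : nat -> nat.
Implicit Types (h : Hel d) (x y : nat -> nat).

Lemma happM h1 h2 k t i : happ h2 k t (happ h1 k t i) = happ (mulH h1 h2) k t i.
Proof. by rewrite /happ; case: insub => // o; rewrite lpermM. Qed.

Lemma happ_lt h k t i : (i < d k.+1)%N -> (happ h k t i < d k.+1)%N.
Proof. by rewrite /happ; case: insub => // o; apply: lperm_lt. Qed.

Lemma mulHI h : injective (mulH h).
Proof.
move=> h1 h2 e; apply: functional_extensionality_dep => k.
apply: functional_extensionality_dep => t; apply: (mulgI (h k t)).
by have := f_equal (fun g : Hel d => g k t) e.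
Qed.

(* The action of the part of an element of H_d that lives on the levels >= m,
   i.e. the component in H_(sigma^m d) fixing the ray 1^infinity. *)
Definition act_T (m : nat) h y : nat -> nat :=
  fun j => match j with
           | 0 => y 0%N
           | k.+1 => if (y k != 0%N) && zeros k y then happ h (m + k) (y k) (y k.+1) else y k.+1
           end.

Lemma act_T0 h x : act_H h x = act_T 0 h x.
Proof. by apply: functional_extensionality => -[|j]. Qed.

Lemma act_T_zb_id m h y k : zeros k y -> act_T m h y k = y k.
Proof. by case: k => // k; rewrite zerosS /= => /andP[_ ->]. Qed.

Lemma zb_act_T m h y k : zeros k (act_T m h y) = zeros k y.
Proof.
elim: k => // k IH; rewrite !zerosS IH.
by case zk: (zeros k y) => //=; rewrite act_T_zb_id.
Qed.

Lemma act_T_eq0 m h y : (forall j, act_T m h y j = 0%N) <-> (forall j, y j = 0%N).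
Proof.
have E (z : nat -> nat) : (forall j, z j = 0%N) <-> (forall k, zeros k z).
  split=> [z0 k|zz j]; first by apply/zerosP.
  exact: (zerosP j.+1 z (zz j.+1) j).
by rewrite !E; split=> z k; have := z k; rewrite zb_act_T.
Qed.

Lemma act_TM m h1 h2 y : act_T m h2 (act_T m h1 y) = act_T m (mulH h1 h2) y.
Proof.
apply: functional_extensionality => -[//|k].
rewrite [LHS]/act_T -/(act_T m h1 y) zb_act_T /=.
case zk: (zeros k y); last by rewrite !andbF.
by rewrite act_T_zb_id // !andbT; case: (y k != _) => //; rewrite happM.
Qed.

Lemma act_T_idH m y : act_T m (@idH d) y = y.
Proof.
apply: functional_extensionality => -[//|k] /=; case: ifP => // _.
by rewrite /happ; case: insub => // o; rewrite lperm1.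
Qed.

Lemma act_HM h1 h2 x : act_H h2 (act_H h1 x) = act_H (mulH h1 h2) x.
Proof. by rewrite !act_T0 act_TM. Qed.

Lemma act_H_idH x : act_H (@idH d) x = x.
Proof. by rewrite act_T0 act_T_idH. Qed.

Lemma act_H_zb_id h x k : zeros k x -> act_H h x k = x k.
Proof. by rewrite act_T0; apply: act_T_zb_id. Qed.

Lemma act_H_eq0 h x : (forall j, act_H h x j = 0%N) <-> (forall j, x j = 0%N).
Proof. by rewrite act_T0; apply: act_T_eq0. Qed.

Lemma act_rootM (s t : {perm 'I_(d 0)}) x :
  act_root t (act_root s x) = act_root (s * t)%g x.
Proof. by apply: functional_extensionality => -[|j] //=; rewrite lpermM. Qed.

Lemma act_rootK (s : {perm 'I_(d 0)}) : cancel (act_root s) (act_root s^-1%g).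
Proof.
by move=> x; rewrite act_rootM mulgV; apply: functional_extensionality => -[|j] //=; rewrite lperm1.
Qed.

Lemma valid_root (s : {perm 'I_(d 0)}) x : valid d x -> valid d (act_root s x).
Proof. by move=> vx [|j] /=; rewrite ?lperm_lt ?vx. Qed.

Lemma valid_H h x : valid d x -> valid d (act_H h x).
Proof. by move=> vx [|j] /=; [|case: ifP => _; rewrite ?happ_lt]; rewrite ?vx. Qed.

(** With [tailn_act_H_root] and [tailn_act_H_other] this lists the sections of [h]: its deeper part
    at a vertex of the ray, a rooted permutation at a vertex hanging off the ray by one letter, the
    identity elsewhere. *)
Lemma tailn_act_H_zero m h x : zeros m x -> tailn m (act_H h x) = act_T m h (tailn m x).
Proof.
move=> zm; apply: functional_extensionality => -[|k]; rewrite /tailn.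
  by rewrite addn0 act_H_zb_id // /act_T addn0.
rewrite addnS [LHS]/act_H [RHS]/act_T -/(zeros _ _) zerosD zm /= -addnS.
by [].
Qed.

Definition act_head n (s : {perm 'I_n}) y : nat -> nat :=
  fun j => if j is 0 then lperm s (y 0%N) else y j.

Definition hroot h m x : {perm 'I_(d m.+1)} :=
  if insub (x m) is Some o then h m o else 1%g.

Lemma tailn_act_H_root m h x : zeros m x -> x m != 0%N ->
  tailn m.+1 (act_H h x) = act_head (hroot h m x) (tailn m.+1 x).
Proof.
move=> zm xm; apply: functional_extensionality => -[|k]; rewrite /tailn.
  rewrite addn0 /= -/(zeros m x) xm zm /= addn0 /happ /hroot.
  by case: insub => // ; rewrite lperm1.
rewrite addSn [LHS]/act_H -/(zeros _ _) addnS -addSn zerosD zerosS (negbTE xm) !andbF.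
by rewrite /= addnS.
Qed.

Lemma tailn_act_H_other m h x : ~~ zeros m x -> tailn m.+1 (act_H h x) = tailn m.+1 x.
Proof.
move=> zm; apply: functional_extensionality => k; rewrite /tailn.
by rewrite addSn [LHS]/act_H -/(zeros _ _) zerosD (negbTE zm) !andbF.
Qed.

Lemma eq_act_H_below m h x y : (forall i, (i < m)%N -> x i = y i) ->
  forall i, (i < m)%N -> act_H h x i = act_H h y i.
Proof.
move=> e [|i] lt /=; first exact: e.
rewrite -!/(zeros i _) (@eq_zeros i x y); last by move=> j ltj; apply: e; lia.
by rewrite !e //; lia.
Qed.

Lemma eq_act_root_below m (s : {perm 'I_(d 0)}) x y : (forall i, (i < m)%N -> x i = y i) ->
  forall i, (i < m)%N -> act_root s x i = act_root s y i.
Proof. by move=> e [|i] lt /=; rewrite e. Qed.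

End Actions.

Lemma In_nth_ord (T : Type) (x0 x : T) (s : seq T) : List.In x s ->
  exists i : 'I_(size s), nth x0 s i = x.
Proof.
elim: s => //= y s IH [->|/IH[i <-]]; first by exists ord0.
by exists (lift ord0 i).
Qed.

Lemma In_nth_mem (T : Type) (x0 : T) (s : seq T) (i : 'I_(size s)) : List.In (nth x0 s i) s.
Proof.
case: i => i /=; elim: s i => //= y s IH [|i] lt /=; [by left|right; exact: IH].
Qed.

Lemma NoDup_nth_inj (T : Type) (x0 : T) (s : seq T) : List.NoDup s ->
  injective (fun i : 'I_(size s) => nth x0 s i).
Proof.
elim: s => [|y s IH] nd /= [i lti] [j ltj]; first by [].
have [nin nd'] : ~ List.In y s /\ List.NoDup s by inversion nd.
case: i lti => [|i] lti; case: j ltj => [|j] ltj //= e; apply/val_inj => //=.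
- by case: nin; rewrite e; apply: (In_nth_mem x0 (Ordinal (ltj : (j < size s)%N))).
- by case: nin; rewrite -e; apply: (In_nth_mem x0 (Ordinal (lti : (i < size s)%N))).
congr S; exact: (congr1 val (IH nd' (Ordinal (lti : (i < size s)%N)) (Ordinal (ltj : (j < size s)%N)) e)).
Qed.

(** * Words in the generators, their lamps, and inverse words *)

Section Words.
Variables (d : nat -> nat) (F : finGroupType) (Hs : seq (Hel d)).
Notation ST := ({perm 'I_(d 0)} * 'I_(size Hs) * F * {perm 'I_(d 0)})%type.
Implicit Types (a : ST) (l : seq ST) (x : nat -> nat).

Definition Hs_elem (i : 'I_(size Hs)) : Hel d := nth (@idH d) Hs i.

Definition st_s a : {perm 'I_(d 0)} := a.1.1.1.
Definition st_i a : 'I_(size Hs) := a.1.1.2.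
Definition st_f a : F := a.1.2.
Definition st_t a : {perm 'I_(d 0)} := a.2.

Definition step_act a x : nat -> nat :=
  act_root (st_t a) (act_H (Hs_elem (st_i a)) (act_root (st_s a) x)).

Definition step_lamp a x : F :=
  if pb (forall j, act_root (st_s a) x j = 0%N) then st_f a else 1%g.

Definition wseq l : WE F := foldr (fun a acc => wmul (step_elem a) acc) (wone F) l.

Lemma wprod_seq n (w : {ffun 'I_n -> ST}) : wprod w = wseq [seq w i | i <- enum 'I_n].
Proof. by rewrite /wprod /wseq foldr_map. Qed.

Lemma wg_cons a l x : wg (wseq (a :: l)) x = wg (wseq l) (step_act a x).
Proof. by case: a => -[[s i] f] t. Qed.

(** The factor from H fixes 1^infinity, so the position of the lamp may be tested before that factor
    acts. *)
Lemma wphi_cons a l x : wphi (wseq (a :: l)) x = (step_lamp a x * wphi (wseq l) (step_act a x))%g.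
Proof.
case: a => -[[s i] f] t /=; rewrite mul1g mulg1 mul1g; congr (_ * _)%g.
by rewrite /step_lamp /=; congr (if _ then _ else _); apply: eq_pb; apply: act_H_eq0.
Qed.

Lemma valid_sact a x : valid d x -> valid d (step_act a x).
Proof. by move=> vx; do ![apply: valid_root|apply: valid_H]. Qed.

Lemma valid_wg l x : valid d x -> valid d (wg (wseq l) x).
Proof.
by elim: l x => [//|a l IH] x vx; rewrite wg_cons; apply: IH; apply: valid_sact.
Qed.

Lemma wg_cat u v x : wg (wseq (u ++ v)) x = wg (wseq v) (wg (wseq u) x).
Proof. by elim: u x => [//|a u IH] x; rewrite cat_cons !wg_cons IH. Qed.

Lemma wphi_cat u v x :
  wphi (wseq (u ++ v)) x = (wphi (wseq u) x * wphi (wseq v) (wg (wseq u) x))%g.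
Proof.
elim: u x => [|a u IH] x; first by rewrite mul1g.
by rewrite cat_cons !wphi_cons IH wg_cons mulgA.
Qed.

Lemma eq_sact_below m a x y : (forall i, (i < m)%N -> x i = y i) ->
  forall i, (i < m)%N -> step_act a x i = step_act a y i.
Proof.
move=> /(eq_act_root_below (st_s a)) /(eq_act_H_below (Hs_elem (st_i a))).
exact: eq_act_root_below.
Qed.

Hypothesis Hnd : List.NoDup Hs.
Hypothesis Hid : List.In (@idH d) Hs.
Hypothesis Hmul : forall h1 h2, List.In h1 Hs -> List.In h2 Hs -> List.In (mulH h1 h2) Hs.

Lemma hel_inj : injective Hs_elem.
Proof. exact: NoDup_nth_inj. Qed.

Lemma hel_mul_ex i j : exists k, Hs_elem k = mulH (Hs_elem i) (Hs_elem j).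
Proof. by apply: In_nth_ord; apply: Hmul; apply: In_nth_mem. Qed.

Definition hmul i j := epsilon (inhabits i) (fun k => Hs_elem k = mulH (Hs_elem i) (Hs_elem j)).

Lemma hel_mul i j : Hs_elem (hmul i j) = mulH (Hs_elem i) (Hs_elem j).
Proof. exact: (epsilon_spec (inhabits i) _ (hel_mul_ex i j)). Qed.

Lemma hmulI i : injective (hmul i).
Proof. by move=> j k /(congr1 Hs_elem); rewrite !hel_mul => /mulHI /hel_inj. Qed.

(** Closure under products suffices: left translation by [i] is an injection of a finite set, hence
    reaches the identity. The right inverse is two-sided because the product is componentwise in
    groups. *)
Lemma hel_inv_ex i : exists j, mulH (Hs_elem i) (Hs_elem j) = @idH d /\ mulH (Hs_elem j) (Hs_elem i) = @idH d.
Proof.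
have [e he] := In_nth_ord (@idH d) Hid.
have [g _ gK] := injF_bij (@hmulI i).
exists (g e); have E : mulH (Hs_elem i) (Hs_elem (g e)) = @idH d by rewrite -hel_mul gK.
split=> //; move: (Hs_elem i) (Hs_elem (g e)) E => h1 h2 E.
apply: functional_extensionality_dep => k; apply: functional_extensionality_dep => t.
have Ekt : (h1 k t * h2 k t = 1)%g by have := f_equal (fun h : Hel d => h k t) E.
by rewrite /mulH /idH -[h2 k t](mulKg (h1 k t)) Ekt mulg1 mulVg.
Qed.

Definition hinv i := epsilon (inhabits i)
  (fun j => mulH (Hs_elem i) (Hs_elem j) = @idH d /\ mulH (Hs_elem j) (Hs_elem i) = @idH d).

Lemma hel_inv i : mulH (Hs_elem i) (Hs_elem (hinv i)) = @idH d /\ mulH (Hs_elem (hinv i)) (Hs_elem i) = @idH d.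
Proof. exact: (epsilon_spec (inhabits i) _ (hel_inv_ex i)). Qed.

Lemma hinvK : involutive hinv.
Proof.
move=> i; apply: hel_inj; apply: (@mulHI _ (Hs_elem (hinv i))).
by rewrite (hel_inv i).2 (hel_inv (hinv i)).1.
Qed.

(** The inverse of a step has the same shape, since the lamp at 1^infinity commutes with H. *)
Definition sinv a : ST := ((st_t a)^-1%g, hinv (st_i a), (st_f a)^-1%g, (st_s a)^-1%g).

Lemma sinvK : involutive sinv.
Proof. by case=> -[[s i] f] t; rewrite /sinv /st_s /st_i /st_f /st_t /= !invgK hinvK. Qed.

Lemma sactK a : cancel (step_act a) (step_act (sinv a)).
Proof.
by move=> x; rewrite /step_act /= act_rootK act_HM (hel_inv _).1 act_H_idH act_rootK.
Qed.

Lemma sact_invK a : cancel (step_act (sinv a)) (step_act a).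
Proof. by move=> x; rewrite -{1}(sinvK a) sactK. Qed.

Lemma slamp_inv a x : (step_lamp a x * step_lamp (sinv a) (step_act a x) = 1)%g.
Proof.
rewrite /step_lamp /step_act /= act_rootK (eq_pb (act_H_eq0 _ _)).
by case: ifP => _; rewrite ?mulgV ?mulg1.
Qed.

Definition rinv l := rev (map sinv l).

Lemma rinv_cons a l : rinv (a :: l) = rinv l ++ [:: sinv a].
Proof. by rewrite /rinv /= rev_cons cats1. Qed.

Lemma wg_rinv l x : wg (wseq (rinv l)) (wg (wseq l) x) = x.
Proof.
by elim: l x => [//|a l IH] x; rewrite rinv_cons wg_cat [wg (wseq (a :: l)) x]wg_cons IH wg_cons sactK.
Qed.

Lemma wphi_rinv l x : (wphi (wseq l) x * wphi (wseq (rinv l)) (wg (wseq l) x) = 1)%g.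
Proof.
elim: l x => [|a l IH] x; first by rewrite /= mulg1.
rewrite rinv_cons wphi_cat [wg (wseq (a :: l)) x]wg_cons [wphi (wseq (a :: l)) x]wphi_cons wg_rinv -mulgA (mulgA _ _ (wphi _ (step_act a x))).
by rewrite IH mul1g wphi_cons /= mulg1 slamp_inv.
Qed.

Lemma is_one_rinv u l :
  (forall x, valid d x -> wg (wseq u) x = wg (wseq l) x /\ wphi (wseq u) x = wphi (wseq l) x) ->
  is_one d (wseq (u ++ rinv l)).
Proof.
move=> e x vx; have [eg ep] := e x vx.
by rewrite wg_cat wphi_cat eg ep wg_rinv wphi_rinv.
Qed.

End Words.

(** * The trajectory of one vertex *)

Section Potential.
Variables (K : realFieldType) (d : nat -> nat).
Hypothesis d2 : forall j, (2 <= d j)%N.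
Implicit Types (x y : nat -> nat).

Definition level_rate j : K := ((d j)%:R - 1) / (d j)%:R ^+ 2.

Fixpoint rate_prod k j : K := if k is k'.+1 then level_rate j * rate_prod k' j.+1 else 1.

(* The expected time until the next alternation at level j + k (see alternations
   below) of the chain formed by the letters from j on; the first component is its
   value just before an element of H is applied, the second one just before the
   letter j is refreshed. *)
Fixpoint potential k j x (md : bool) : K * K :=
  if k is k'.+1 then
    let vu := potential k' j.+1 x md in
    (if x j == 0%N then vu.1 / level_rate j else vu.2 / level_rate j + (d j)%:R,
     vu.1 / level_rate j / (d j)%:R + (1 - (d j)%:R^-1) * (vu.2 / level_rate j + (d j)%:R))
  else ((~~ md)%:R, 0).

Lemma dK_ge2 j : 2 <= (d j)%:R :> K.
Proof. by rewrite ler_nat. Qed.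

Lemma level_rate_gt0 j : 0 < level_rate j.
Proof. by have := dK_ge2 j; rewrite /level_rate => dj; rewrite divr_gt0 ?exprn_gt0 //; lra. Qed.

Lemma level_rate_le4 j : level_rate j <= 1 / 4.
Proof.
have := dK_ge2 j; rewrite /level_rate; move: (d j)%:R => D hD.
rewrite ler_pdivrMr; last by rewrite exprn_gt0; lra.
by have := sqr_ge0 (D - 2); rewrite !expr2; nra.
Qed.

Lemma rate_prod_gt0 k j : 0 < rate_prod k j.
Proof. by elim: k j => [|k IH] j //=; rewrite mulr_gt0 ?level_rate_gt0. Qed.

Lemma rate_prod_le1 k j : rate_prod k j <= 1.
Proof.
elim: k j => [|k IH] j //=.
have := IH j.+1; have := rate_prod_gt0 k j.+1; have := level_rate_gt0 j; have := level_rate_le4 j; nra.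
Qed.

Lemma d_level_rate_le1 j : (d j)%:R * level_rate j <= 1.
Proof.
have := dK_ge2 j; rewrite /level_rate; move: (d j)%:R => D hD.
rewrite mulrA ler_pdivrMr; last by rewrite exprn_gt0; lra.
by rewrite expr2; nra.
Qed.

(** The term [- 4/3 * rate_prod k j] makes the bound inductive. With [q = rate_prod k j.+1], the
    added [d j] costs at most [q] because [d j * level_rate j <= 1], and [level_rate j <= 1/4] gives
    back [4/3 * (1 - 1/4) * q = q]. The constant 7/3 makes the bound equal to 1 at [k = 0]. *)
Lemma potential_bounds k j x md :
  let M := (7/3 - 4/3 * rate_prod k j) / rate_prod k j in
  (0 <= (potential k j x md).1 <= M) /\ (0 <= (potential k j x md).2 <= M).
Proof.
elim: k j => [|k IH] j /=; first by case: md => /=; lra.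
have := IH j.+1; case: (potential k j.+1 x md) => v u /=.
have p0 := level_rate_gt0 j; have pi0 := rate_prod_gt0 k j.+1; have p4 := level_rate_le4 j.
have D2 := dK_ge2 j; have Dp := d_level_rate_le1 j.
move: (level_rate j) (rate_prod k j.+1) (d j)%:R p0 pi0 p4 D2 Dp => p q D p0 pi0 p4 D2 Dp.
set M' := _ / q; set M := _ / (p * q) => -[/andP[v0 vM] /andP[u0 uM]].
have MM : M' / p + D <= M.
  rewrite /M' /M ler_pdivlMr ?mulr_gt0 // mulrDl.
  have -> : (7 / 3 - 4 / 3 * q) / q / p * (p * q) = 7 / 3 - 4 / 3 * q.
    by field; apply/andP; split; lra.
  have : D * p * q <= q by rewrite ler_piMl // ltW.
  have : p * q <= 1 / 4 * q by rewrite ler_pM2r.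
  rewrite mulrA; lra.
have vp : 0 <= v / p <= M' / p by rewrite divr_ge0 ?(ltW p0) //= ler_pM2r // invr_gt0.
have up : 0 <= u / p <= M' / p by rewrite divr_ge0 ?(ltW p0) //= ler_pM2r // invr_gt0.
have i0 : 0 < D^-1 by rewrite invr_gt0; lra.
have i1 : D^-1 <= 1 by rewrite invf_le1; lra.
move: (v / p) (u / p) (M' / p) (D^-1) vp up i0 i1 MM => a b m i va ub i0 i1 MM.
by case: ifP => _; split; apply/andP; split; nra.
Qed.

Lemma potential_le3 k j x md :
  (0 <= (potential k j x md).1 <= 3 / rate_prod k j) /\ (0 <= (potential k j x md).2 <= 3 / rate_prod k j).
Proof.
have [/andP[v0 vM] /andP[u0 uM]] := potential_bounds k j x md.
have le3 : (7/3 - 4/3 * rate_prod k j) / rate_prod k j <= 3 / rate_prod k j.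
  by rewrite ler_pM2r ?invr_gt0 ?rate_prod_gt0 //; have := rate_prod_gt0 k j; lra.
by rewrite v0 u0 (le_trans vM le3) (le_trans uM le3).
Qed.

Lemma eq_potential k j x y md :
  ((forall i, (j <= i < j + k)%N -> x i = y i) -> (potential k j x md).1 = (potential k j y md).1) /\
  ((forall i, (j < i < j + k)%N -> x i = y i) -> (potential k j x md).2 = (potential k j y md).2).
Proof.
elim: k j => [//|k IH] j /=; have [IHv IHu] := IH j.+1.
split=> e.
  have -> : x j = y j by apply: e; rewrite leqnn -addSnnS leq_addr.
  by rewrite IHv ?IHu // => i lt; apply: e; move: lt; lia.
by rewrite IHv ?IHu // => i lt; apply: e; move: lt; lia.
Qed.

End Potential.

Lemma avg_if0 (K : realFieldType) n (A B : K) : (0 < n)%N ->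
  avg (fun c : 'I_n => if val c == 0%N then A else B) = A / n%:R + (1 - n%:R^-1) * B.
Proof.
case: n => // n _; rewrite /avg big_ord_recl /= card_ord.
rewrite sumr_const card_ord -(mulr_natr B).
have n1 : n.+1%:R != 0 :> K by rewrite pnatr_eq0.
have -> : n%:R = n.+1%:R - 1 :> K by rewrite -natr1 addrK.
by move: (n.+1%:R) n1 => N N0; field.
Qed.

(** * Drift of the potential along the walk, and the two estimates on alternations *)

Section Chain.
Variables (K : realFieldType) (d : nat -> nat) (F : finGroupType) (Hs : seq (Hel d)).
Notation ST := ({perm 'I_(d 0)} * 'I_(size Hs) * F * {perm 'I_(d 0)})%type.
Implicit Types (a : ST) (l : seq ST) (x : nat -> nat).
Hypothesis d2 : forall j, (2 <= d j)%N.
Hypothesis Hid : List.In (@idH d) Hs.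
Hypothesis Huni : forall m (t : 'I_(d m)), val t != 0%N -> forall sigma : {perm 'I_(d m.+1)},
  (count (fun h : Hel d => h m t == sigma) Hs * (d m.+1)`! = size Hs)%N.

Lemma Hs_gt0 : (0 < #|'I_(size Hs)|)%N.
Proof. by rewrite card_ord; case: (Hs) Hid. Qed.

Lemma ST_gt0 : (0 < #|{: ST}|)%N.
Proof.
rewrite !card_prod !muln_gt0 Hs_gt0 !andbT /= -andbA; apply/and3P.
by split; apply/card_gt0P; exists 1%g.
Qed.

(** Group the elements of [Hs] by their component at [t]; by [Huni] all fibres have the same
    cardinality. *)
Lemma avg_hel_perm m (t : 'I_(d m)) (G : {perm 'I_(d m.+1)} -> K) : val t != 0%N ->
  avg (fun i => G (@Hs_elem d Hs i m t)) = avg G.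
Proof.
move=> t0; rewrite /avg card_ord /Hs_elem.
rewrite -(big_mkord xpredT (fun i => G (nth (@idH d) Hs i m t))).
rewrite -(big_nth (@idH d) xpredT (fun h : Hel d => G (h m t))) /=.
under eq_bigr => h _.
  rewrite (_ : G (h m t) = \sum_s (h m t == s)%:R * G s); first over.
  by rewrite (bigD1 (h m t)) //= eqxx mul1r big1 ?addr0 // => s; rewrite eq_sym => /negbTE ->; rewrite mul0r.
rewrite exchange_big /= !mulr_suml; apply: eq_bigr => s _.
rewrite -mulr_suml mulrAC [RHS]mulrC; congr (_ * _).
have -> : \sum_(h <- Hs) (h m t == s)%:R = (count (fun h : Hel d => h m t == s) Hs)%:R :> K.
  by rewrite -sum1_count natr_sum [RHS]big_mkcond; apply: eq_bigr => h _; case: eqP.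
rewrite card_Sn -(Huni t0 s) natrM.
have c0 : (count (fun h : Hel d => h m t == s) Hs)%:R != 0 :> K.
  rewrite pnatr_eq0; apply/eqP => c0; have := Huni t0 s; rewrite c0 mul0n.
  by move=> e; have := Hs_gt0; rewrite card_ord -e.
have f0 : (d m.+1)`!%:R != 0 :> K by rewrite pnatr_eq0 -lt0n fact_gt0.
by move: (_%:R) (_%:R) c0 f0 => u v u0 v0; field; apply/andP.
Qed.

Lemma avg_hel_letter m x (A B : K) : valid d x -> x m != 0%N ->
  avg (fun i => if happ (@Hs_elem d Hs i) m (x m) (x m.+1) == 0%N then A else B) =
  A / (d m.+1)%:R + (1 - (d m.+1)%:R^-1) * B.
Proof.
move=> vx xm; pose t : 'I_(d m) := Ordinal (vx m); pose c : 'I_(d m.+1) := Ordinal (vx m.+1).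
rewrite -avg_if0; last by have := d2 m.+1; lia.
rewrite -(avg_perm _ c) -(avg_hel_perm (t := t)) //.
apply: eq_avg => i; rewrite /happ (_ : insub (x m) = Some t) ?(lperm_ord _ c) //.
exact: (insubT (fun i => i < d m)%N (vx m)).
Qed.

(** The vertices followed have level [m.+1]: image 1^(m+1) is an event b, which disarms the count,
    and image 1^m t with t nonzero is an event a, which rearms it. *)
Definition next_mode m x (md : bool) := if zeros m.+1 x then false else if zeros m x then true else md.

(** The second identity is the drift: the potential drops by 1 per step on average, and a counted
    alternation adds the inverse rate. The first one is needed by the induction on [k]: if letter
    [j] is 0 both pass through the recursion of [potential], and otherwise [h] refreshes letter
    [j.+1] only. *)
Lemma avg_potential_H m k j x md : (j + k = m.+1)%N -> valid d x -> zeros j x ->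
  let h i := act_H (@Hs_elem d Hs i) x in
  let P := (md && zeros m.+1 x)%:R / rate_prod K d k j in
  avg (fun i => (potential K d k j (h i) (next_mode m x md)).1) = (potential K d k j x md).1 + P /\
  avg (fun i => (potential K d k j (h i) (next_mode m x md)).2) = (potential K d k j x md).1 - 1 + P.
Proof.
elim: k j => [|k IH] j jk vx zj h P.
  rewrite addn0 in jk; rewrite /P /= /next_mode -jk zj !avg_const ?Hs_gt0 // andbT divr1.
  by case: (md) => /=; split; ring.
have p0 := level_rate_gt0 K d2 j; have q0 := rate_prod_gt0 K d2 k j.+1; have D2 := dK_ge2 K d2 j.
have hj i : h i j = x j by apply: act_H_zb_id.
case xj: (x j == 0%N).
  have zj1 : zeros j.+1 x by rewrite zerosS zj xj.
  have [] := IH j.+1 _ vx zj1; first by lia.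
  rewrite -/h /P /= xj; set P' := _ / _ => EV EU.
  have -> : (md && zeros m.+1 x)%:R / (level_rate K d j * rate_prod K d k j.+1) = P' / level_rate K d j.
    by rewrite /P' invfM mulrA mulrAC.
  rewrite (eq_avg (g := fun i => (level_rate K d j)^-1 * (potential K d k j.+1 (h i) (next_mode m x md)).1)).
    2: by move=> i; rewrite hj xj mulrC.
  rewrite avgZ EV; split; first by rewrite mulrC mulrDl.
  rewrite (eq_avg (g := fun i =>
    ((level_rate K d j)^-1 / (d j)%:R) * (potential K d k j.+1 (h i) (next_mode m x md)).1 +
    (((1 - (d j)%:R^-1) / level_rate K d j) * (potential K d k j.+1 (h i) (next_mode m x md)).2 +
     (1 - (d j)%:R^-1) * (d j)%:R))); last by move=> i; ring.
  rewrite !avgD !avgZ EV EU avg_const ?Hs_gt0 //.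
  clear EV EU; move: (potential K d k j.+1 x md).1 P' => v p'; rewrite /level_rate; move: (d j)%:R D2 => D D2.
  clear jk; by field; rewrite ?andbT; apply/andP; split; lra.
have zm1 : zeros m.+1 x = false.
  by apply/negbTE/negP => /zerosP/(_ j) e; move: xj; rewrite e //; lia.
rewrite {}/P zm1 andbF mul0r !addr0.
(* Here [j = m], an event a: the mode becomes true and the innermost potential vanishes. *)
case: k IH jk q0 => [|k] IH jk q0.
  have jm : j = m by lia.
  rewrite /next_mode zm1 -jm zj /=; split.
    by rewrite (eq_avg (g := fun=> 0 / level_rate K d j + (d j)%:R)) ?avg_const ?Hs_gt0 ?xj // => i; rewrite hj xj.
  rewrite avg_const ?Hs_gt0 // xj; move: (d j)%:R (level_rate K d j) p0 D2 => D p p0 D2.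
  clear jk jm; by field; apply/andP; split; lra.
have zm : zeros m x = false.
  by apply/negbTE/negP => /zerosP/(_ j) e; move: xj; rewrite e //; lia.
(* Letter [j] is the first nonzero one, and [h] alters only the letter right after it. *)
have hother i i' : i' != j.+1 -> h i i' = x i'.
  case: i' => // i' ne; rewrite /h /act_H -/(zeros i' x).
  case zi: (zeros i' x); last by rewrite andbF.
  have [lt|gt|e] := ltngtP i' j; last by rewrite e eqxx in ne.
  - by rewrite (zerosP _ _ zj) // eqxx.
  - by move: xj; rewrite (zerosP _ _ zi j gt) eqxx.
rewrite /next_mode zm1 zm.
have EU i : (potential K d k.+1 j.+1 (h i) md).2 = (potential K d k.+1 j.+1 x md).2.
  by apply: (eq_potential K d k.+1 j.+1 (h i) x md).2 => i' lt; apply: hother; lia.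
(* Averaging over a uniform letter [j.+1] turns the first component at [j.+1] into the second. *)
have EV : avg (fun i => (potential K d k.+1 j.+1 (h i) md).1) = (potential K d k.+1 j.+1 x md).2.
  rewrite [RHS]/= -(avg_hel_letter _ _ vx) ?xj //; apply: eq_avg => i /=.
  rewrite -/(zeros j x) zj xj /=.
  have -> : (potential K d k j.+2 (h i) md).1 = (potential K d k j.+2 x md).1.
    by apply: (eq_potential K d k j.+2 (h i) x md).1 => i' lt; apply: hother; lia.
  have -> // : (potential K d k j.+2 (h i) md).2 = (potential K d k j.+2 x md).2.
  by apply: (eq_potential K d k j.+2 (h i) x md).2 => i' lt; apply: hother; lia.
have VUS y md' : potential K d k.+2 j y md' = 
    (if y j == 0%N then (potential K d k.+1 j.+1 y md').1 / level_rate K d j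
     else (potential K d k.+1 j.+1 y md').2 / level_rate K d j + (d j)%:R,
     (potential K d k.+1 j.+1 y md').1 / level_rate K d j / (d j)%:R +
     (1 - (d j)%:R^-1) * ((potential K d k.+1 j.+1 y md').2 / level_rate K d j + (d j)%:R)) by [].
rewrite [potential K d k.+2 j x md]VUS xj; split.
  rewrite (eq_avg (g := fun=> (potential K d k.+1 j.+1 x md).2 / level_rate K d j + (d j)%:R)) ?avg_const ?Hs_gt0 //.
  by move=> i; rewrite VUS hj xj EU.
rewrite (eq_avg (g := fun i =>
    ((level_rate K d j)^-1 / (d j)%:R) * (potential K d k.+1 j.+1 (h i) md).1 +
    (1 - (d j)%:R^-1) * ((potential K d k.+1 j.+1 x md).2 / level_rate K d j + (d j)%:R))); last first.
  by move=> i; rewrite VUS EU; congr (_ + _); rewrite -mulrA mulrC.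
rewrite avgD avgZ EV avg_const ?Hs_gt0 //.
cbn [fst]; move: (potential _ _ _ _ _ _).2 (d j)%:R (level_rate K d j) p0 D2 => u D p p0 D2.
clear jk; by field; apply/andP; split; lra.
Qed.

Variable m : nat.

(* The number of events b that follow an event a, or are the first event; md tells
   whether the next event b counts. *)
Fixpoint alternations l x (md : bool) : nat :=
  if l is a :: l' then
    let y := act_root (st_s a) x in
    ((md && zeros m.+1 y) + alternations l' (step_act a x) (next_mode m y md))%N
  else 0.

Lemma eq_alternations l x x' md : (forall i, (i < m.+1)%N -> x i = x' i) -> alternations l x md = alternations l x' md.
Proof.
elim: l x x' md => [//|a l IH] x x' md e /=.
have e1 := eq_act_root_below (st_s a) e.
have z1 := eq_zeros e1.
have -> : next_mode m (act_root (st_s a) x) md = next_mode m (act_root (st_s a) x') md.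
  by rewrite /next_mode z1 (eq_zeros (k := m) (fun i lt => e1 i (ltnW lt))).
by rewrite z1; congr addn; apply: IH; apply: eq_sact_below.
Qed.

Local Notation pi := (rate_prod K d m.+1 0).
Local Notation U x md := (potential K d m.+1 0 x md).2.
Local Notation V x md := (potential K d m.+1 0 x md).1.

Lemma pi_gt0 : 0 < pi. Proof. exact: rate_prod_gt0. Qed.

Lemma U_root (s : {perm 'I_(d 0)}) x md : U (act_root s x) md = U x md.
Proof. by apply: (eq_potential K d m.+1 0 (act_root s x) x md).2 => -[]. Qed.

Lemma avg_V_root x md : valid d x -> avg (fun s : {perm 'I_(d 0)} => V (act_root s x) md) = U x md.
Proof.
move=> vx /=; rewrite -avg_if0; last by have := d2 0; lia.
rewrite -(avg_perm _ (Ordinal (vx 0%N))); apply: eq_avg => s /=.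
rewrite (lperm_ord s (Ordinal (vx 0%N))).
have e i : (1 <= i)%N -> act_root s x i = x i by case: i.
have -> : (potential K d m 1 (act_root s x) md).1 = (potential K d m 1 x md).1.
  by apply: (eq_potential K d m 1 (act_root s x) x md).1 => i /andP[/e].
have -> // : (potential K d m 1 (act_root s x) md).2 = (potential K d m 1 x md).2.
by apply: (eq_potential K d m 1 (act_root s x) x md).2 => i /andP[/ltnW/e].
Qed.

Lemma avg_potential_step y md : valid d y ->
  avg (fun r : 'I_(size Hs) * F * {perm 'I_(d 0)} =>
    U (act_root r.2 (act_H (Hs_elem r.1.1) y)) (next_mode m y md)) =
  V y md - 1 + (md && zeros m.+1 y)%:R / pi.
Proof.
move=> vy; have [] := @avg_potential_H m m.+1 0 y md _ vy _ => // _ <-.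
rewrite avg_pair avg_pair; apply: eq_avg => i.
rewrite (eq_avg (g := fun _ : F => U (act_H (Hs_elem i) y) (next_mode m y md))) => [|f].
  by rewrite avg_const //; apply/card_gt0P; exists 1%g.
rewrite (eq_avg (g := fun=> U (act_H (Hs_elem i) y) (next_mode m y md))) => [|t]; last exact: U_root.
by rewrite avg_const //; apply/card_gt0P; exists 1%g.
Qed.

Lemma avg_ST (G : ST -> K) :
  avg G = avg (fun s => avg (fun r : 'I_(size Hs) * F * {perm 'I_(d 0)} => G (s, r.1.1, r.1.2, r.2))).
Proof.
rewrite avg_pair avg_pair avg_pair; apply: eq_avg => s.
by rewrite avg_pair avg_pair; apply: eq_avg => i; apply: eq_avg.
Qed.

Lemma rest_gt0 : (0 < #|{: 'I_(size Hs) * F * {perm 'I_(d 0)}}|)%N.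
Proof.
rewrite !card_prod !muln_gt0 Hs_gt0 /=; apply/andP.
by split; apply/card_gt0P; exists 1%g.
Qed.

Lemma perm_gt0 n : (0 < #|{perm 'I_n}|)%N.
Proof. by apply/card_gt0P; exists 1%g. Qed.

(** The sum of [U] and the elapsed time, minus the alternations so far divided by [pi], is a
    martingale, and the final value of [U] is at most [3 / pi]. *)
Lemma wavg_alternations_le n x md : valid d x ->
  wavg n (fun l => (alternations l x md)%:R) <= pi * (n%:R + 3 / pi - U x md).
Proof.
elim: n x md => [|n IH] x md vx.
  have [_ /andP[_ uM]] := potential_le3 K d2 m.+1 0 x md.
  by rewrite [wavg _ _]/= add0r mulr_ge0 ?(ltW pi_gt0) // subr_ge0.
have -> : pi * (n.+1%:R + 3 / pi - U x md) = avg (fun s : {perm 'I_(d 0)} =>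
    pi * (n.+1%:R + 3 / pi) + - pi * V (act_root s x) md).
  by rewrite avgD avg_const ?perm_gt0 // avgZ avg_V_root //; ring.
rewrite /= avg_ST; apply: le_avg => s; set y := act_root s x.
have vy : valid d y by apply: valid_root.
have -> : pi * (n.+1%:R + 3 / pi) + - pi * V y md = avg (fun r : 'I_(size Hs) * F * {perm 'I_(d 0)} =>
    (md && zeros m.+1 y)%:R + pi * (n%:R + 3 / pi) + - pi * U (act_root r.2 (act_H (Hs_elem r.1.1) y)) (next_mode m y md)).
  rewrite avgD avg_const ?rest_gt0 // avgZ avg_potential_step // -natr1.
  by have := lt0r_neq0 pi_gt0; move: pi (V y md) => p v p0; field.
apply: le_avg => -[[i f] t] /=.
under eq_wavg do rewrite natrD.
rewrite wavgD wavg_const ?ST_gt0 // -addrA lerD2l.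
apply: le_trans (IH _ _ _) _; first exact: valid_sact.
by rewrite mulNr -mulrBr.
Qed.

(** In mode true the count vanishes exactly when no event b occurs. The quantity [1 + pi / 3 * U]
    lies between 1 and 2 and has drift [- pi / 3] as long as no event b occurs, hence shrinks in
    mean at least by the factor [1 - pi / 6]. *)
Lemma wavg_no_alternation_le n x : valid d x ->
  wavg n (fun l => (alternations l x true == 0)%:R) <= (1 + pi / 3 * U x true) * (1 - pi / 6) ^+ n.
Proof.
have pi1 := rate_prod_le1 K d2 m.+1 0; have pi0 := pi_gt0.
elim: n x => [|n IH] x vx.
  have [_ /andP[u0 _]] := potential_le3 K d2 m.+1 0 x true.
  by rewrite [wavg _ _]/= mulr1 lerDl mulr_ge0 // divr_ge0 // ltW.
have -> : (1 + pi / 3 * U x true) * (1 - pi / 6) ^+ n.+1 = avg (fun s : {perm 'I_(d 0)} =>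
    (1 - pi / 6) ^+ n.+1 + (1 - pi / 6) ^+ n.+1 * (pi / 3) * V (act_root s x) true).
  by rewrite avgD avg_const ?perm_gt0 // avgZ avg_V_root //; ring.
rewrite /= avg_ST; apply: le_avg => s; set y := act_root s x.
have vy : valid d y by apply: valid_root.
have [/andP[v0 vM] _] := potential_le3 K d2 m.+1 0 y true.
have t0 : 0 <= 1 - pi / 6 by lra.
have tn0 := exprn_ge0 n t0; have tn1 := exprn_ge0 n.+1 t0.
case zy: (zeros m.+1 y).
  rewrite (eq_avg (g := fun=> 0)) ?avg_const ?rest_gt0 //.
    have q0 : 0 <= pi / 3 by lra.
    by rewrite addr_ge0 // mulr_ge0 // mulr_ge0.
  by move=> r; rewrite (eq_wavg (G' := fun=> 0)) ?wavg_const ?ST_gt0 // => l _; rewrite /= -/y zy.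
have step : avg (fun r : 'I_(size Hs) * F * {perm 'I_(d 0)} =>
    (1 - pi / 6) ^+ n + (1 - pi / 6) ^+ n * (pi / 3) * U (act_root r.2 (act_H (Hs_elem r.1.1) y)) true)
    <= (1 - pi / 6) ^+ n.+1 + (1 - pi / 6) ^+ n.+1 * (pi / 3) * V y true.
  have sr := avg_potential_step true vy; rewrite zy mul0r addr0 in sr.
  have nm : next_mode m y true = true by rewrite /next_mode zy; case: ifP.
  rewrite nm in sr; rewrite avgD avg_const ?rest_gt0 // avgZ sr exprS.
  move: vM; rewrite ler_pdivlMr // => vM.
  move: ((1 - pi / 6) ^+ n) (V y true) tn0 vM v0 => t v t0' vM v0.
  have -> : t + t * (pi / 3) * (v - 1) = t * (1 + pi / 3 * v - pi / 3) by ring.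
  have -> : (1 - pi / 6) * t + (1 - pi / 6) * t * (pi / 3) * v = t * ((1 - pi / 6) * (1 + pi / 3 * v)) by ring.
  rewrite ler_wpM2l //; nra.
apply: le_trans step; apply: le_avg => -[[i f] t] /=.
apply: le_trans (_ : (1 + pi / 3 * U (step_act (s, i, f, t) x) true) * (1 - pi / 6) ^+ n <= _).
  apply: le_trans (IH _ _); last exact: valid_sact.
  apply: le_wavg => l _; rewrite /= /next_mode -/y zy.
  by case: ifP.
by rewrite /step_act /= -/y; lra.
Qed.

End Chain.

(** * Upper bound for the return probability *)

Section Vertices.
Variable (d : nat -> nat).
Hypothesis d2 : forall j, (2 <= d j)%N.

Definition vertex m := {dffun forall i : 'I_m, 'I_(d i)}.

Lemma card_vertex m : #|{: vertex m}| = (\prod_(i < m) d i)%N.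
Proof.
rewrite card_dep_ffun foldrE big_map big_enum.
by apply: eq_bigr => i _; rewrite card_ord.
Qed.

Lemma d_gt0 j : (0 < d j)%N. Proof. by have := d2 j; lia. Qed.

(** The padding by 0 is arbitrary: what is computed from such a point at level [m] depends on its
    first [m] letters only. *)
Definition vertex_point m (v : vertex m) : nat -> nat :=
  fun j => if insub j is Some o then val (v o) else 0%N.

Definition vertex_of m (x : nat -> nat) : vertex m :=
  [ffun i : 'I_m => insubd (Ordinal (d_gt0 i)) (x i) : 'I_(d i)].

Lemma vertex_point_valid m (v : vertex m) : valid d (vertex_point v).
Proof.
move=> j; rewrite /vertex_point; case: insubP => [o _ <-|_]; last exact: d_gt0.
exact: ltn_ord.
Qed.

Lemma vertex_point_ord m (v : vertex m) (i : 'I_m) : vertex_point v i = v i.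
Proof. by rewrite /vertex_point valK. Qed.

Lemma vertex_point_of m x : valid d x -> forall i, (i < m)%N -> vertex_point (vertex_of m x) i = x i.
Proof.
by move=> vx i lt; rewrite (vertex_point_ord _ (Ordinal lt)) ffunE /= insubdK //; apply: vx.
Qed.

Lemma vertex_ext m (v w : vertex m) : (forall i, (i < m)%N -> vertex_point v i = vertex_point w i) -> v = w.
Proof.
move=> e; apply/ffunP => i; apply: val_inj.
by rewrite /= -!vertex_point_ord; apply: e.
Qed.

End Vertices.

Section UpperBound.
Variables (K : realFieldType) (d : nat -> nat) (F : finGroupType) (Hs : seq (Hel d)).
Notation ST := ({perm 'I_(d 0)} * 'I_(size Hs) * F * {perm 'I_(d 0)})%type.
Notation SH := ({perm 'I_(d 0)} * 'I_(size Hs) * {perm 'I_(d 0)})%type.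
Implicit Types (a : ST) (l : seq ST) (x : nat -> nat) (u : seq SH) (r : SH).
Hypothesis d2 : forall j, (2 <= d j)%N.
Hypothesis Hnd : List.NoDup Hs.
Hypothesis Hid : List.In (@idH d) Hs.
Hypothesis Hmul : forall h1 h2, List.In h1 Hs -> List.In h2 Hs -> List.In (mulH h1 h2) Hs.
Hypothesis Huni : forall m (t : 'I_(d m)), val t != 0%N -> forall sigma : {perm 'I_(d m.+1)},
  (count (fun h : Hel d => h m t == sigma) Hs * (d m.+1)`! = size Hs)%N.

Definition step_of r (f : F) : ST := (r.1.1, r.1.2, f, r.2).
Definition word_of u (fs : seq F) : seq ST := [seq step_of p.1 p.2 | p <- zip u fs].

Lemma avg_mk (G : ST -> K) : avg G = avg (fun r => avg (fun f => G (step_of r f))).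
Proof.
rewrite avg_pair avg_pair avg_pair avg_pair avg_pair; apply: eq_avg => s.
by apply: eq_avg => i; rewrite avg_exchange.
Qed.

(** Separates the lamps from the S- and H-parts, which alone decide the trajectories
    ([alternations_word_of]). *)
Lemma wavg_mkw n (G : seq ST -> K) :
  wavg n G = wavg n (fun u => wavg n (fun fs => G (word_of u fs))).
Proof.
elim: n G => [//|n IH] G /=; rewrite avg_mk; apply: eq_avg => r.
by rewrite wavg_avg; apply: eq_avg => f; rewrite IH.
Qed.

Variable m : nat.
Let V := vertex d m.+1.

Lemma alternations_word_of u fs fs' x md : size fs = size u -> size fs' = size u ->
  alternations m (word_of u fs) x md = alternations m (word_of u fs') x md.
Proof.
elim: u fs fs' x md => [|r u IH] [|f fs] [|f' fs'] x md //= [e] [e'].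
by congr addn; apply: IH.
Qed.

Lemma alternations0_wphi l x : alternations m l x true = 0%N -> wphi (wseq l) x = 1%g.
Proof.
elim: l x => [//|a l IH] x; rewrite [alternations _ _ _ _]/= /next_mode.
case zy: (zeros m.+1 _) => // c0; rewrite wphi_cons IH.
  rewrite mulg1 /step_lamp; case: pbP => // z.
  by move: zy; have -> : zeros m.+1 (act_root (st_s a) x) by apply/zerosP => i _; apply: z.
by move: c0; rewrite if_same.
Qed.

Definition visited l : nat := \sum_(v : V) (0 < alternations m l (vertex_point v) true).

Definition lamp_pt (s : {perm 'I_(d 0)}) : nat -> nat := act_root s^-1%g (fun=> 0%N).

Lemma lamp_pt_valid s : valid d (lamp_pt s).
Proof. by apply: valid_root => j; apply: d_gt0. Qed.

Lemma act_lamp_pt s : act_root s (lamp_pt s) = fun=> 0%N.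
Proof. by rewrite /lamp_pt -{1}(invgK s) act_rootK. Qed.

Lemma pref_sact_inj a : injective (fun v : V => vertex_of d2 m.+1 (step_act a (vertex_point v)) : V).
Proof.
move=> v w e; apply: vertex_ext => i lt.
have e2 j : (j < m.+1)%N -> step_act a (vertex_point v) j = step_act a (vertex_point w) j.
  move=> ltj; have vs := vertex_point_valid d2.
  by rewrite -(vertex_point_of d2 (valid_sact a (vs _ v)) ltj) e vertex_point_of //; apply: valid_sact.
by have := eq_sact_below (sinv a) e2 lt; rewrite !sactK.
Qed.

(** The rooted factor of [a] brings exactly one vertex to 1^(m+1), the prefix of [lamp_pt]; every
    other vertex stays in mode true. So one vertex is gained at most, and only if the rest of the
    word misses it. *)
Lemma visited_cons a l :
  (visited (a :: l) <= visited l + (alternations m l (step_act a (lamp_pt (st_s a))) true == 0))%N.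
Proof.
have -> : visited l = (\sum_(v : V) (0 < alternations m l (step_act a (vertex_point v)) true))%N.
  rewrite /visited (reindex_inj (@pref_sact_inj a)); apply: eq_bigr => v _.
  congr (nat_of_bool (0 < _)%N); apply: eq_alternations => i lt.
  by rewrite vertex_point_of //; apply: valid_sact; apply: vertex_point_valid.
pose v0 : V := vertex_of d2 m.+1 (lamp_pt (st_s a)).
have v0E i : (i < m.+1)%N -> vertex_point v0 i = lamp_pt (st_s a) i.
  by move=> lt; rewrite vertex_point_of //; apply: lamp_pt_valid.
rewrite /visited (bigD1 v0) // [in leqRHS](bigD1 v0) //=.
have -> : alternations m l (step_act a (vertex_point v0)) true = alternations m l (step_act a (lamp_pt (st_s a))) true.
  by apply: eq_alternations; apply: eq_sact_below.
have -> : (\sum_(v | v != v0) (0 < zeros m.+1 (act_root (st_s a) (vertex_point v)) +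
    alternations m l (step_act a (vertex_point v)) (next_mode m (act_root (st_s a) (vertex_point v)) true)) =
   \sum_(v | v != v0) (0 < alternations m l (step_act a (vertex_point v)) true))%N.
  apply: eq_bigr => v ne; rewrite /next_mode; case: ifP => [zv|_]; last by rewrite if_same.
  case/eqP: ne; apply: vertex_ext => i lt; rewrite v0E //.
  have e j : (j < m.+1)%N -> act_root (st_s a) (vertex_point v) j = (fun=> 0%N) j by apply: (zerosP _ _ zv).
  by rewrite -(act_rootK (st_s a) (vertex_point v)); apply: (eq_act_root_below _ e).
rewrite addnAC leq_add2r.
by case: (alternations m l (step_act a (lamp_pt (st_s a))) true) => [|n]; apply: leq_b1.
Qed.

(** The target [c] is arbitrary so that the induction can condition on the first lamp: the rest of
    the word must then realise the corrected target [c' f]. The lamps [nseq (size u) 1%g] merely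
    fill in a word whose trajectories are those of [u]. *)
Lemma lamp_count u (c : (nat -> nat) -> F) :
  wavg (size u) (fun fs => (pb (forall y, valid d y -> wphi (wseq (word_of u fs)) y = c y))%:R)
    <= (#|F|%:R^-1 : K) ^+ visited (word_of u (nseq (size u) 1%g)).
Proof.
have F0 : (0 < #|F|)%N by apply/card_gt0P; exists 1%g.
have q0 : 0 <= #|F|%:R^-1 :> K by rewrite invr_ge0.
have q1 : #|F|%:R^-1 <= 1 :> K by rewrite invf_le1 ?ltr0n // ler1n.
elim: u c => [|r u IH] c.
  have -> : visited (word_of [::] (nseq (size ([::] : seq SH)) 1%g)) = 0%N.
    by rewrite /visited big1.
  by rewrite expr0 /= lern1; case: pb.
pose a := step_of r 1%g; set R := visited (word_of u (nseq (size u) 1%g)) in IH.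
pose nv := alternations m (word_of u (nseq (size u) 1%g)) (step_act a (lamp_pt (st_s a))) true == 0%N.
apply: le_trans (_ : #|F|%:R^-1 ^+ (R + nv) <= _); last first.
  by apply: ler_wiXn2l => //; apply: (visited_cons a).
rewrite [wavg _ _]/=.
pose c' f y := ((step_lamp (step_of r f) (step_act (sinv a) y))^-1 * c (step_act (sinv a) y))%g.
pose f0 := c (lamp_pt (st_s a)).
apply: le_trans (_ : avg (fun f => (nv ==> (f == f0))%:R * #|F|%:R^-1 ^+ R) <= _).
  apply: le_avg => f; apply: le_trans (_ : (nv ==> (f == f0))%:R * wavg (size u) (fun fs =>
      (pb (forall y, valid d y -> wphi (wseq (word_of u fs)) y = c' f y))%:R) <= _); last first.
    by rewrite ler_wpM2l ?ler0n.
  rewrite -wavgZ; apply: le_wavg => fs sfs; case: pbP => // H; last by rewrite mulr_ge0.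
  have H1 y : valid d y -> (step_lamp (step_of r f) y * wphi (wseq (word_of u fs)) (step_act a y))%g = c y.
    by move=> vy; rewrite -(H y vy); exact: esym (wphi_cons (step_of r f) (word_of u fs) y).
  case: pbP => [_|[]]; last first.
    move=> y vy; rewrite /c'; apply: (mulgI (step_lamp (step_of r f) (step_act (sinv a) y))).
    by rewrite mulKVg -H1 ?sact_invK //; apply: valid_sact.
  (* If the vertex is not met again, the rest of the word has trivial lamp at [lamp_pt], so the
     first lamp is forced to be [f0]; this gives the factor [1 / #|F|]. *)
  rewrite mulr1 ler_nat; case nvE: nv => //=.
  rewrite (_ : f == f0) //; apply/eqP; rewrite /f0 -H1; last exact: lamp_pt_valid.
  rewrite alternations0_wphi ?mulg1; last first.
    by rewrite (alternations_word_of (fs' := nseq (size u) 1%g)) ?size_nseq //; apply/eqP.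
  by rewrite /step_lamp /= act_lamp_pt; case: pbP => // -[].
have -> : avg (fun f => (nv ==> (f == f0))%:R * #|F|%:R^-1 ^+ R) =
   #|F|%:R^-1 ^+ R * avg (fun f : F => (nv ==> (f == f0))%:R : K).
  by rewrite -avgZ; apply: eq_avg => f; rewrite mulrC.
rewrite exprD ler_wpM2l ?exprn_ge0 //; case: (nv) => /=; last by rewrite avg_const.
rewrite /avg (bigD1 f0) //= eqxx big1 ?addr0 ?mul1r // => f /negbTE -> //.
Qed.

Lemma prob_one_le n :
  wavg n (fun l => (pb (is_one d (wseq l)))%:R) <=
  (#|F|%:R^-1 : K) ^+ #|{: V}| + #|{: V}|%:R * (2 * (1 - rate_prod K d m.+1 0 / 6) ^+ n).
Proof.
have F0 : (0 < #|F|)%N by apply/card_gt0P; exists 1%g.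
have q0 : 0 <= #|F|%:R^-1 :> K by rewrite invr_ge0.
have q1 : #|F|%:R^-1 <= 1 :> K by rewrite invf_le1 ?ltr0n // ler1n.
set D := #|{: V}|.
(* Either all [D] vertices are visited and the first term is the bound of [lamp_count], or the sum
   is at least 1. *)
apply: le_trans (_ : wavg n (fun l => #|F|%:R^-1 ^+ D + \sum_(v : V) (alternations m l (vertex_point v) true == 0%N)%:R) <= _).
  rewrite !wavg_mkw; apply: le_wavg => u su.
  have := lamp_count u (fun=> 1%g); rewrite su => le1.
  apply: le_trans (_ : #|F|%:R^-1 ^+ visited (word_of u (nseq n 1%g)) <= _).
    apply: le_trans le1; apply: le_wavg => fs _; rewrite ler_nat.
    case: pbP => // H; case: pbP => // -[] y vy; exact: (H y vy).2.
  rewrite -[leLHS](wavg_const F0 n); apply: le_wavg => fs sfs.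
  rewrite (_ : \sum_(v : V) _ = \sum_(v : V) (alternations m (word_of u (nseq n 1%g)) (vertex_point v) true == 0%N)%:R); last first.
    by apply: eq_bigr => v _; rewrite (alternations_word_of (fs' := nseq n 1%g)) ?size_nseq ?su.
  move: (word_of u _) => l.
  have E : (visited l + \sum_(v : V) (alternations m l (vertex_point v) true == 0))%N = D.
    rewrite /visited -big_split /= (eq_bigr (fun=> 1%N)) ?sum1_card // => v _.
    by case: alternations.
  rewrite -natr_sum; case: (posnP (\sum_(v : V) (alternations m l (vertex_point v) true == 0))) E => [->|p] E.
    by rewrite addr0 -E addn0.
  apply: le_trans (_ : 1 <= _); first exact: exprn_ile1.
  apply: le_trans (_ : 0 + 1 <= _); first by rewrite add0r.
  by apply: lerD; rewrite ?exprn_ge0 ?ler1n.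
rewrite wavgD wavg_const ?ST_gt0 // lerD2l wavg_sum.
have -> : D%:R = \sum_(v : V) 1 :> K by rewrite sumr_const.
rewrite mulr_suml; apply: ler_sum => v _; rewrite mul1r.
apply: le_trans (wavg_no_alternation_le K F d2 Hid Huni m n (vertex_point_valid d2 v)) _.
have pi0 := pi_gt0 K d2 m; have pi1 := rate_prod_le1 K d2 m.+1 0.
rewrite ler_wpM2r ?exprn_ge0 //; first by lra.
have [_ /andP[u0]] := potential_le3 K d2 m.+1 0 (vertex_point v) true.
rewrite ler_pdivlMr // => uM; nra.
Qed.
End UpperBound.

(** * Lower bound for the return probability *)

Lemma act_headM n (s t : {perm 'I_n}) y : act_head t (act_head s y) = act_head (s * t)%g y.
Proof. by apply: functional_extensionality => -[|j] //=; rewrite lpermM. Qed.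

Lemma act_head1 n y : act_head (1 : {perm 'I_n})%g y = y.
Proof. by apply: functional_extensionality => -[|j] //=; rewrite lperm1. Qed.

Section Separated.
Variable A : Type.
Definition sep (s : seq A) : seq (option A) := rcons (map Some s) None.

(** [None] serves both as terminator and as default of [nth], so streams are compared position by
    position without regard to their lengths. *)
Lemma sep_inj s s' r r' :
  (forall i, nth None (sep s ++ r) i = nth None (sep s' ++ r') i) ->
  s = s' /\ (forall i, nth None r i = nth None r' i).
Proof.
elim: s s' => [|x s IH] [|x' s'] e.
- by split=> // i; apply: (e i.+1).
- by have := e 0%N.
- by have := e 0%N.
have [-> e'] := IH s' (fun i => e i.+1); split=> //.
by have [->] := e 0%N.
Qed.

Lemma flatten_sep_inj (I : eqType) (f f' : I -> seq A) (s : seq I) :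
  (forall i, nth None (flatten [seq sep (f v) | v <- s]) i =
             nth None (flatten [seq sep (f' v) | v <- s]) i) ->
  forall v, v \in s -> f v = f' v.
Proof.
elim: s => //= v s IH /sep_inj [e /IH{}IH] w; rewrite inE => /orP[/eqP->//|]; exact: IH.
Qed.

Lemma size_flatten_sep (I : Type) (f : I -> seq A) (s : seq I) :
  size (flatten [seq sep (f v) | v <- s]) = (\sum_(v <- s) size (f v) + size s)%N.
Proof.
elim: s => [|v s IH] /=; first by rewrite big_nil.
by rewrite size_cat size_rcons size_map IH big_cons; lia.
Qed.
End Separated.

Section LowerBound.
Variables (K : realFieldType) (d : nat -> nat) (F : finGroupType) (Hs : seq (Hel d)).
Notation ST := ({perm 'I_(d 0)} * 'I_(size Hs) * F * {perm 'I_(d 0)})%type.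
Implicit Types (a : ST) (l : seq ST) (x y : nat -> nat).
Hypothesis d2 : forall j, (2 <= d j)%N.
Hypothesis Hnd : List.NoDup Hs.
Hypothesis Hid : List.In (@idH d) Hs.
Hypothesis Hmul : forall h1 h2, List.In h1 Hs -> List.In h2 Hs -> List.In (mulH h1 h2) Hs.
Hypothesis Huni : forall m (t : 'I_(d m)), val t != 0%N -> forall sigma : {perm 'I_(d m.+1)},
  (count (fun h : Hel d => h m t == sigma) Hs * (d m.+1)`! = size Hs)%N.

Variable m : nat.
Notation Sm := {perm 'I_(d m.+1)}.
Notation letter := ('I_(size Hs) * F * Sm)%type.
Implicit Types (c : Sm * seq letter).

Definition lamp (f : F) y : F := if pb (forall j, y j = 0%N) then f else 1%g.

Fixpoint eval_letters (L : seq letter) y : F * (nat -> nat) :=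
  if L is (i, f, s) :: L' then
    let r := eval_letters L' (act_head s (act_T m.+1 (Hs_elem i) y)) in ((lamp f y * r.1)%g, r.2)
  else (1%g, y).

Definition eval_code c y := eval_letters c.2 (act_head c.1 y).

(** Left multiplication by an element of HF in reduced form: two HF letters not separated by a
    nontrivial permutation are merged, which ties the length to the alternations. *)
Definition push_letter i f c : Sm * seq letter :=
  if c.1 == 1%g then
    if c.2 is (j, g, s) :: L' then (1%g, (hmul i j, (f * g)%g, s) :: L') else (1%g, [:: (i, f, 1%g)])
  else (1%g, (i, f, c.1) :: c.2).

Lemma eval_push_letter i f c y :
  eval_code (push_letter i f c) y = ((lamp f y * (eval_code c (act_T m.+1 (Hs_elem i) y)).1)%g, (eval_code c (act_T m.+1 (Hs_elem i) y)).2).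
Proof.
case: c => s L; rewrite /eval_code /push_letter /=; case: eqP => [->|_]; last by rewrite /= act_head1.
case: L => [|[[j g] t] L] /=; rewrite !act_head1 //=.
rewrite hel_mul // -act_TM mulgA; congr ((_ * _)%g, _).
(* The H-factor fixes 1^infinity, so the two lamps sit at the same point and multiply. *)
rewrite /lamp (eq_pb (act_T_eq0 _ (Hs_elem i) y)).
by case: pb; rewrite ?mulg1.
Qed.

(** Reduced word of the section of [l] at the vertex below which [x] lies: an event b contributes an
    HF letter, an event a a permutation. It is assembled from the end of [l]. *)
Fixpoint vertex_code l x : Sm * seq letter :=
  if l is a :: l' then
    let y := act_root (st_s a) x in
    let c := vertex_code l' (step_act a x) in
    if zeros m.+1 y then push_letter (st_i a) (st_f a) c
    else if zeros m y then ((hroot (Hs_elem (st_i a)) m y * c.1)%g, c.2)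
    else c
  else (1%g, [::]).

Lemma eq_vertex_code l x x' : (forall i, (i < m.+1)%N -> x i = x' i) -> vertex_code l x = vertex_code l x'.
Proof.
elim: l x x' => [//|a l IH] x x' e /=.
have e1 := eq_act_root_below (st_s a) e.
rewrite (IH (step_act a x) (step_act a x')); last exact: eq_sact_below.
rewrite (eq_zeros e1) (eq_zeros (k := m) (fun i lt => e1 i (ltnW lt))).
by rewrite /hroot (e1 m).
Qed.

Lemma vertex_codeP l x : valid d x ->
  wphi (wseq l) x = (eval_code (vertex_code l x) (tailn m.+1 x)).1 /\
  tailn m.+1 (wg (wseq l) x) = (eval_code (vertex_code l x) (tailn m.+1 x)).2.
Proof.
elim: l x => [|a l IH] x vx; first by rewrite /eval_code /= act_head1.
rewrite wphi_cons wg_cons [vertex_code _ _]/=; set y := act_root _ x; set c := vertex_code l _.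
have [-> ->] := IH _ (valid_sact a vx); rewrite -/c.
have -> : tailn m.+1 (step_act a x) = tailn m.+1 (act_H (Hs_elem (st_i a)) y) by [].
have tx : tailn m.+1 x = tailn m.+1 y by [].
have slamp1 : ~~ zeros m.+1 y -> step_lamp a x = 1%g.
  move=> zy; rewrite /step_lamp -/y; case: pbP => // z; case/negP: zy.
  by apply/zerosP => i _; apply: z.
case zy: (zeros m.+1 y).
  rewrite tailn_act_H_zero // eval_push_letter tx; split=> //; congr (_ * _)%g.
  rewrite /step_lamp /lamp -/y; congr (if _ then _ else _); apply: eq_pb.
  split=> [z j|z j]; first exact: z.
  have [lt|ge] := ltnP j m.+1; first exact: (zerosP _ _ zy).
  by have := z (j - m.+1)%N; rewrite /tailn subnKC.
rewrite slamp1 ?zy // mul1g; case zm: (zeros m y).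
  rewrite tailn_act_H_root // /eval_code ?act_headM //.
  by apply/negP => ym; move: zy; rewrite zerosS zm ym.
by rewrite tailn_act_H_other ?zm.
Qed.

(** The code grows from the end of the word while the mode runs from its beginning, so both modes
    are needed at once. In mode false an initial b is not counted, and it adds no letter of its own
    once a previous HF letter stands to its left. *)
Lemma size_vertex_code l x :
  (size (vertex_code l x).2 <= alternations m l x true)%N /\
  (size (vertex_code l x).2 <= alternations m l x false + ((vertex_code l x).1 == 1%g))%N.
Proof.
elim: l x => [//|a l IH] x /=; have [] := IH (step_act a x).
rewrite /next_mode; case: (vertex_code l _) => s L /=.
case: (zeros m.+1 _) => /=; last by case: (zeros m _) => //= *; split=> //; lia.
rewrite /push_letter /=; case: eqP => [_|_] le1 le2; last by rewrite /= eqxx; lia.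
by case: L le1 le2 => [|[[j g] t] L] /= le1 le2; rewrite eqxx; lia.
Qed.

Local Notation V := (vertex d m.+1).
Local Notation D := #|{: V}|.

(** The length [9 * D] leaves room for [8 * D] letters and one separator per vertex. *)
Definition enc_type : finType :=
  ((9 * D).-tuple (option letter) * {ffun V -> Sm} * {ffun V -> V})%type.

Definition stream l := flatten [seq sep (vertex_code l (vertex_point v)).2 | v <- enum V].

Definition enc l : enc_type :=
  ([tuple nth None (stream l) i | i < 9 * D], [ffun v => (vertex_code l (vertex_point v)).1],
   [ffun v => vertex_of d2 m.+1 (wg (wseq l) (vertex_point v))]).

Definition total l := (\sum_(v : V) size (vertex_code l (vertex_point v)).2)%N.

Lemma size_stream l : size (stream l) = (total l + D)%N.
Proof. by rewrite size_flatten_sep -cardE big_enum. Qed.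

Lemma eq_wg_below l x x' : (forall i, (i < m.+1)%N -> x i = x' i) ->
  forall i, (i < m.+1)%N -> wg (wseq l) x i = wg (wseq l) x' i.
Proof.
elim: l x x' => [//|a l IH] x x' e; rewrite !wg_cons; apply: IH.
exact: eq_sact_below.
Qed.

(** Under the bound on [total] the stream is stored in full, so the sections at all vertices of
    level [m.+1] are recovered; with the images of these vertices they determine the action and the
    lamps. *)
Lemma enc_inj l l' : (total l <= 8 * D)%N -> (total l' <= 8 * D)%N -> enc l = enc l' ->
  forall x, valid d x -> wg (wseq l) x = wg (wseq l') x /\ wphi (wseq l) x = wphi (wseq l') x.
Proof.
move=> tl tl' [e1 e2 e3] x vx.
pose v := vertex_of d2 m.+1 x.
have vE i : (i < m.+1)%N -> vertex_point v i = x i by apply: vertex_point_of.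
have se i : nth None (stream l) i = nth None (stream l') i.
  have [lt|ge] := ltnP i (9 * D); last by rewrite !nth_default // size_stream; lia.
  have := congr1 (fun t => nth None t i) e1.
  have E (s : seq (option letter)) : nth None [tuple nth None s j | j < 9 * D] i = nth None s i.
    by rewrite -[i]/(nat_of_ord (Ordinal lt)) -tnth_nth tnth_mktuple.
  by rewrite !E.
have ec2 : (vertex_code l (vertex_point v)).2 = (vertex_code l' (vertex_point v)).2.
  by apply: (flatten_sep_inj se); rewrite mem_enum.
have ec1 : (vertex_code l (vertex_point v)).1 = (vertex_code l' (vertex_point v)).1.
  by have := congr1 (fun f : {ffun V -> Sm} => f v) e2; rewrite !ffunE.
have ec : vertex_code l x = vertex_code l' x.
  rewrite -!(eq_vertex_code _ vE); move: ec1 ec2.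
  by case: (vertex_code l _) => ? ?; case: (vertex_code l' _) => ? ? /= -> ->.
have [p1 t1] := vertex_codeP l vx; have [p2 t2] := vertex_codeP l' vx.
rewrite p1 p2 ec; split=> //; apply: functional_extensionality => i.
have [lt|ge] := ltnP i m.+1; last first.
  have := congr1 (fun f : nat -> nat => f (i - m.+1)%N) (etrans t1 (etrans (congr1 (fun c => (eval_code c (tailn m.+1 x)).2) ec) (esym t2))).
  by rewrite /tailn subnKC.
rewrite -!(eq_wg_below _ vE lt).
have := congr1 (fun f : {ffun V -> V} => vertex_point (f v) i) e3.
by rewrite !ffunE !vertex_point_of //; apply: valid_wg; apply: vertex_point_valid.
Qed.

(** Each vertex has at most [1 + 3 = 4] alternations in mean, so [total] has mean at most [4 * D],
    and the Markov inequality at [8 * D] leaves probability 1/2. *)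
Lemma prob_total n : n%:R * rate_prod K d m.+1 0 <= 1 ->
  1 / 2 <= wavg n (fun l => (total l <= 8 * D)%N%:R : K).
Proof.
move=> np; have D0 : (0 < D)%N.
  by rewrite card_vertex; apply: prodn_gt0 => i; apply: d_gt0.
have D0' : 0 < D%:R :> K by rewrite ltr0n.
have le1 : wavg n (fun l => (total l)%:R) <= D%:R * 4 :> K.
  apply: le_trans (_ : wavg n (fun l => \sum_(v : V) (alternations m l (vertex_point v) true)%:R) <= _).
    apply: le_wavg => l _; rewrite -natr_sum ler_nat; apply: leq_sum => v _.
    exact: (size_vertex_code _ _).1.
  rewrite wavg_sum; have -> : D%:R * 4 = \sum_(v : V) 4 :> K.
    by rewrite sumr_const -[RHS]mulr_natl.
  apply: ler_sum => v _; apply: le_trans (wavg_alternations_le K F d2 Hid Huni m n true (vertex_point_valid d2 v)) _.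
  have [_ /andP[u0 _]] := potential_le3 K d2 m.+1 0 (vertex_point v) true.
  have pi0 := pi_gt0 K d2 m; move: (potential _ _ _ _ _ _).2 (rate_prod _ _ _ _) u0 pi0 np => u p u0 p0 np.
  have -> : p * (n%:R + 3 / p - u) = n%:R * p + 3 - p * u by field; lra.
  have : 0 <= p * u by rewrite mulr_ge0 // ltW.
  by lra.
have : 1 - wavg n (fun l => (total l <= 8 * D)%N%:R : K) <= 1 / 2; last by lra.
rewrite -{1}(wavg_const (ST_gt0 F Hid) n 1) -[X in _ - X]mul1r -mulNr -wavgZ -wavgD.
apply: le_trans (_ : wavg n (fun l => (8 * D%:R)^-1 * (total l)%:R) <= _).
  apply: le_wavg => l _; case: leqP => [_|gt].
    by rewrite mulr1 subrr mulr_ge0 ?invr_ge0 ?mulr_ge0.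
  rewrite mulr0 addr0 ler_pdivlMl ?mulr_gt0 // mulr1 -natrM ler_nat; exact: ltnW.
rewrite wavgZ ler_pdivrMl ?mulr_gt0 //; lra.
Qed.

(** By pigeonhole some code [e] carries mass at least [1 / (2 * k)] among the words with small
    [total]. Two independent words with code [e] give the same group element, and the second may be
    replaced by its inverse. *)
Lemma prob_one_ge n : n%:R * rate_prod K d m.+1 0 <= 1 ->
  ((2 * #|enc_type|%:R)^-1) ^+ 2 <= wavg (n + n) (fun l => (pb (is_one d (wseq l)))%:R : K).
Proof.
move=> np; set k := #|enc_type|.
have good := prob_total np.
pose G e l : K := ((total l <= 8 * D)%N && (enc l == e))%:R.
have [e Ge] : exists e, (2 * k%:R)^-1 <= wavg n (G e).
  case: (pickP (fun e => (2 * k%:R)^-1 <= wavg n (G e))) => [e He|none]; first by exists e.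
  have k0 : (0 < k)%N by apply/card_gt0P; exists (enc [::]).
  have : \sum_e wavg n (G e) < \sum_(e : enc_type) (2 * k%:R)^-1.
    apply: ltr_sum => [|e _]; first by apply/hasP; exists (enc [::]); rewrite ?mem_index_enum.
    by rewrite ltNge none.
  have -> : \sum_(e : enc_type) (2 * k%:R)^-1 = 1 / 2 :> K.
    rewrite sumr_const -[LHS]mulr_natl -[#|_|]/k; field.
    by rewrite pnatr_eq0 -lt0n.
  rewrite -wavg_sum.
  have -> : wavg n (fun l => \sum_e G e l) = wavg n (fun l => (total l <= 8 * D)%N%:R : K).
    apply: eq_wavg => l _; rewrite (bigD1 (enc l)) //= /G eqxx andbT big1 ?addr0 // => e.
    by rewrite eq_sym => /negbTE ->; rewrite andbF.
  by rewrite ltNge good.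
have k0 : 0 <= (2 * k%:R)^-1 :> K by rewrite invr_ge0 mulr_ge0.
apply: le_trans (_ : wavg n (G e) * wavg n (G e) <= _).
  by rewrite expr2 ler_pM.
rewrite wavg_cat -wavgZ; apply: le_wavg => u _.
(* The second half of the word is rewritten as [rinv l] with [l] uniform. *)
rewrite -[leRHS]wavg_rev -[leRHS](wavg_map _ _ (inv_inj (sinvK Hnd Hid Hmul))).
rewrite mulrC -wavgZ; apply: le_wavg => l _.
rewrite -natrM mulnb ler_nat; case: andP => //= -[/andP[tu /eqP eu] /andP[tl /eqP el]].
case: pbP => // -[]; apply: is_one_rinv => //; apply: enc_inj => //.
by rewrite eu el.
Qed.

Lemma card_enc : #|enc_type| =
  ((size Hs * #|F| * (d m.+1)`!).+1 ^ (9 * D) * (d m.+1)`! ^ D * D ^ D)%N.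
Proof.
by rewrite /enc_type !card_prod card_tuple !card_ffun card_option !card_prod card_ord card_Sn.
Qed.

End LowerBound.

End Counting.

(** * The scales k(n) and l(n), and logarithms *)

(** The powers in [retprob], [kcond] and [lcond] are [Nat.pow]. *)
Lemma Nat_powE : Nat.pow = expn.
Proof.
apply: functional_extensionality => a; apply: functional_extensionality => b.
by elim: b => //= b ->; rewrite expnS.
Qed.

Section Scales.
Variables (d : nat -> nat) (B : nat).
Hypothesis d2 : forall j, 2 <= d j.
Hypothesis dB : forall j, d j <= B.

Lemma first_from_before (P : pred nat) k fuel j :
  k <= j -> j < first_from P k fuel -> ~~ P j.
Proof.
elim: fuel k => [|fuel IH] k /=; first by lia.
case Pk: (P k); first by lia.
move=> kj; have [->|ne] := eqVneq j k; first by rewrite Pk.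
by apply: IH; lia.
Qed.

Lemma first_from_at (P : pred nat) k fuel j :
  k <= j -> j < k + fuel -> P j -> P (first_from P k fuel).
Proof.
elim: fuel k => [|fuel IH] k /=; first by lia.
case Pk: (P k) => // kj jf Pj; apply: IH => //; last by lia.
by have [e|] := eqVneq j k; [rewrite -e Pj in Pk|lia].
Qed.

Lemma first_from_ge (P : pred nat) k fuel t :
  (forall j, k <= j -> j < t -> ~~ P j) -> t <= k + fuel -> t <= first_from P k fuel.
Proof.
elim: fuel k => [|fuel IH] k /= nP; first by lia.
move=> tk; case: ifP => Pk.
  by rewrite leqNgt; apply/negP => kt; have := nP k (leqnn k) kt; rewrite Pk.
by apply: IH; [move=> j kj; apply: nP|]; lia.
Qed.

(** The search succeeds within its fuel: [n] itself qualifies, as [2 * (d i - 1) <= d i ^ 2] and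
    [n <= 2 ^ n.+1]. *)
Lemma kcond_kfun n : kcond d n (kfun d n).
Proof.
apply: (@first_from_at _ 0 n.+1 n) => //; rewrite /kcond Nat_powE.
have : 2 ^ n.+1 * \prod_(i < n.+1) (d i).-1 <= \prod_(i < n.+1) d i ^ 2.
  have -> : 2 ^ n.+1 = \prod_(i < n.+1) 2 by rewrite prod_nat_const card_ord.
  rewrite -big_split /=.
  by apply: leq_prod => i _; have := d2 i; nia.
apply: leq_trans; rewrite leq_mul2r; apply/orP; right.
by have := ltn_expl n.+1 (leqnn 2); lia.
Qed.

Lemma prod_d_gt0 k : 0 < \prod_(i < k) d i.
Proof. by apply: prodn_gt0 => i; have := d2 i; lia. Qed.

(** Minimality of [kfun d n] and [d i * (d i - 1) <= d i ^ 2] bound the product without its last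
    factor by [n]; the last factor is at most [B]. *)
Lemma prod_kfun_le n : 0 < n -> \prod_(i < (kfun d n).+1) d i <= B * n.
Proof.
move=> n0; rewrite big_ord_recr /= mulnC leq_mul ?dB //.
case E: (kfun d n) => [|k]; first by rewrite big_ord0.
have : ~~ kcond d n k by apply: (@first_from_before _ 0 n.+1); rewrite // -/(kfun d n) E.
rewrite /kcond Nat_powE -ltnNge => lt.
have Q0 : 0 < \prod_(i < k.+1) (d i).-1 by apply: prodn_gt0 => i; have := d2 i; lia.
rewrite -(leq_pmul2r Q0); apply: leq_trans (ltnW lt).
by rewrite -big_split /=; apply: leq_prod => i _; have := d2 i; nia.
Qed.

(** For such [n] the first failure is positive, so the predecessor in [lfun] is a genuine one and
    [lcond] holds there. *)
Lemma lcond_lfun l n : B ^ (3 * l.+1) <= n -> l <= lfun d n /\ lcond d n (lfun d n).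
Proof.
move=> Bn; have B2 : 2 <= B by apply: leq_trans (d2 0) (dB 0).
have lc j : j <= l -> lcond d n j.
  move=> jl; rewrite /lcond Nat_powE.
  apply: (@leq_trans (\prod_(i < j.+1) B ^ 3)).
    by apply: leq_prod => i _; rewrite leq_exp2r.
  rewrite prod_nat_const card_ord -expnM; apply: (@leq_trans n).
    by apply: leq_trans Bn; rewrite leq_pexp2l //; lia.
  by rewrite leq_pmulr //; apply: prodn_gt0 => i; have := d2 i; lia.
have f1 : l.+1 <= first_from (fun l => ~~ lcond d n l) 0 n.+1.
  apply: first_from_ge => [j _ lt|]; first by rewrite negbK; apply: lc.
  rewrite add0n ltnS; apply: leq_trans Bn; apply: (@leq_trans (3 * l.+1)); first by lia.
  by apply/ltnW/ltn_expl.
rewrite /lfun; split; first by lia.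
rewrite -[lcond _ _ _]negbK; apply: (@first_from_before (fun l => ~~ lcond d n l) 0 n.+1) => //.
by move: f1; case: first_from.
Qed.

Lemma rate_prodE k :
  (rate_prod R d k 0 * (\prod_(i < k) d i ^ 2)%:R = (\prod_(i < k) (d i).-1)%:R)%R.
Proof.
have -> : rate_prod R d k 0 = (\prod_(i < k) level_rate R d i)%R.
  have H j : rate_prod R d k j = (\prod_(i < k) level_rate R d (j + i))%R.
    elim: k j => [|k IH] j /=; first by rewrite big_ord0.
    rewrite big_ord_recl addn0 IH; congr (_ * _)%R.
    by apply: eq_bigr => i _; rewrite addSnnS.
  by rewrite H; apply: eq_bigr.
rewrite !natr_prod -big_split /=; apply: eq_bigr => i _.
have di := d2 i; rewrite /level_rate natrX -mulrA mulVf ?mulr1; last by rewrite expf_neq0 // pnatr_eq0; lia.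
by rewrite -subn1 natrB //; lia.
Qed.

Lemma rate_prod_kcond n k : kcond d n k -> (n%:R * rate_prod R d k.+1 0 <= 1)%R.
Proof.
rewrite /kcond Nat_powE -(ler_nat R) natrM -rate_prodE mulrA.
by rewrite -[leRHS]mul1r ler_pM2r // ltr0n; apply: prodn_gt0 => i; have := d2 i; nia.
Qed.

(** Split [d i ^ 3] as [d i * d i ^ 2]. This is the balance that makes the avoidance probability
    exponentially small in the number of vertices. *)
Lemma rate_prod_lcond n l : lcond d n l -> ((\prod_(i < l.+1) d i)%:R <= n%:R * rate_prod R d l.+1 0)%R.
Proof.
rewrite /lcond Nat_powE -(ler_nat R) natrM -rate_prodE mulrA.
rewrite (eq_bigr (fun i : 'I_l.+1 => d i * d i ^ 2)) => [|i _]; last by rewrite expnS.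
by rewrite big_split /= natrM ler_pM2r // ltr0n; apply: prodn_gt0 => i; have := d2 i; nia.
Qed.

End Scales.

(** * The two bounds for the return probability at an arbitrary time *)

Section ReturnProbability.
Variables (d : nat -> nat) (F : finGroupType) (Hs : seq (Hel d)).
Notation ST := ({perm 'I_(d 0)} * 'I_(size Hs) * F * {perm 'I_(d 0)})%type.
Hypothesis d2 : forall j, 2 <= d j.
Hypothesis Hnd : List.NoDup Hs.
Hypothesis Hid : List.In (@idH d) Hs.
Hypothesis Hmul : forall h1 h2, List.In h1 Hs -> List.In h2 Hs -> List.In (mulH h1 h2) Hs.
Hypothesis Huni : forall m (t : 'I_(d m)), val t != 0%N -> forall sigma : {perm 'I_(d m.+1)},
  (count (fun h : Hel d => h m t == sigma) Hs * (d m.+1)`! = size Hs)%N.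

Lemma retprob_wavg n :
  retprob F Hs n = wavg n (fun l : seq ST => (pb (is_one d (wseq l)))%:R%R : R).
Proof.
rewrite /retprob Nat_powE RdivE !INRE wavg_ffun cardsT; congr (_ / _)%R.
rewrite -sum1dep_card natr_sum [LHS]big_mkcond /=; apply: eq_bigr => w _.
by rewrite wprod_seq; case: pb.
Qed.

Lemma step_one_ge : ((#|{: ST}|%:R)^-1 <= wavg 1 (fun l : seq ST => (pb (is_one d (wseq l)))%:R : R))%R.
Proof.
have [i0 hi0] := In_nth_ord (@idH d) Hid.
pose a0 : ST := (1%g, i0, 1%g, 1%g).
rewrite /= /avg (bigD1 a0) //= mulrDl -[leLHS]addr0 lerD //; last first.
  by rewrite mulr_ge0 ?invr_ge0 ?sumr_ge0.
rewrite -[leLHS]mul1r ler_pM2r ?invr_gt0 ?ltr0n; last exact: ST_gt0.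
case: pbP => // -[] x vx.
have root1 y : act_root (1%g : {perm 'I_(d 0)}) y = y.
  by apply: functional_extensionality => -[|j] //=; rewrite lperm1.
rewrite -[wmul _ _]/(wseq [:: a0]) wg_cons wphi_cons mulg1; split.
  by move=> j; rewrite /step_act /= /Hs_elem hi0 act_H_idH !root1.
by rewrite /step_lamp /=; case: pb.
Qed.

(** The symmetric argument covers even times; for odd [n] one extra step equal to the identity costs
    the factor [1 / #|ST|]. *)
Lemma retprob_ge n m : (n%:R * rate_prod R d m.+1 0 <= 1)%R ->
  ((#|{: ST}|%:R)^-1 * ((2 * #|enc_type F Hs m|%:R)^-1) ^+ 2 <= retprob F Hs n)%R.
Proof.
move=> np; rewrite retprob_wavg.
have hp : (n./2%:R * rate_prod R d m.+1 0 <= 1)%R.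
  apply: le_trans np; rewrite ler_wpM2r ?(ltW (rate_prod_gt0 _ _ _ _)) // ler_nat; lia.
have := prob_one_ge F d2 Hnd Hid Hmul Huni hp; set e := (_ ^+ 2)%R => ge2.
have e0 : (0 <= e)%R by rewrite exprn_ge0 // invr_ge0 mulr_ge0.
have s0 : (0 <= (#|{: ST}|%:R)^-1 :> R)%R by rewrite invr_ge0.
have s1 : ((#|{: ST}|%:R)^-1 <= 1 :> R)%R by rewrite invf_le1 ?ltr0n ?ler1n ST_gt0.
rewrite -[n in wavg n]odd_double_half -addnn; case: odd; last first.
  by rewrite add0n; apply: le_trans ge2; rewrite ler_piMl.
apply: le_trans (_ : wavg 1 (fun l : seq ST => (pb (is_one d (wseq l)))%:R : R) *
    wavg (n./2 + n./2) (fun l : seq ST => (pb (is_one d (wseq l)))%:R : R) <= _)%R.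
  by rewrite ler_pM // step_one_ge.
rewrite [leRHS]wavg_cat mulrC -wavgZ; apply: le_wavg => u _.
rewrite mulrC -wavgZ; apply: le_wavg => v _.
rewrite -natrM mulnb ler_nat; case: andP => //= -[/pbP ou /pbP ov].
case: pbP => // -[] x vx; rewrite wg_cat wphi_cat; have [gu ->] := ou x vx.
have -> : wg (wseq u) x = x by apply: functional_extensionality.
by have [gv ->] := ov x vx; rewrite mulg1.
Qed.

Lemma retprob_le n m :
  (retprob F Hs n <= (#|F|%:R^-1) ^+ (\prod_(i < m.+1) d i) +
    (\prod_(i < m.+1) d i)%:R * (2 * (1 - rate_prod R d m.+1 0 / 6) ^+ n))%R.
Proof.
by rewrite retprob_wavg -card_vertex; exact: (@prob_one_le R d F Hs d2 Hnd Hid Hmul Huni m n).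
Qed.

End ReturnProbability.

(* Gives the key %R back to R_scope. *)
From Stdlib Require Import Reals.

(** * Exponential and logarithmic estimates, and passage to the exponents *)

Section Analysis.
Local Open Scope R_scope.

Lemma INR_leq (a b : nat) : (a <= b)%nat -> INR a <= INR b.
Proof. by move=> /ssrnat.leP; apply: le_INR. Qed.

Lemma INR_pos (a : nat) : (0 < a)%nat -> 0 < INR a.
Proof. by move=> /ssrnat.ltP; apply: lt_0_INR. Qed.

Lemma INRM (a b : nat) : INR (a * b)%nat = INR a * INR b.
Proof. exact: mult_INR. Qed.

Lemma ln_INR_exp (a b : nat) : (0 < a)%nat -> ln (INR (expn a b)) = INR b * ln (INR a).
Proof.
move=> a0; elim: b => [|b IH]; first by rewrite expn0 /= ln_1; rlra.
rewrite expnS INRM ln_mult ?IH ?S_INR; [rlra|exact: INR_pos|].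
by apply: INR_pos; rewrite expn_gt0 a0.
Qed.

Lemma ln_le x y : 0 < x -> x <= y -> ln x <= ln y.
Proof. by move=> x0 [lt|->]; [left; apply: ln_increasing|rlra]. Qed.

Lemma ln_ge0 x : 1 <= x -> 0 <= ln x.
Proof. by move=> x1; rewrite -ln_1; apply: ln_le; rlra. Qed.

Lemma pow_le_exp t y n : 0 <= t -> t <= 1 - y -> t ^ n <= exp (- (INR n * y)).
Proof.
move=> t0 ty; have t1 : t <= exp (- y) by have := exp_ineq1_le (- y); rlra.
elim: n => [|n IH]; first by rewrite /= Rmult_0_l Ropp_0 exp_0; rlra.
have -> : - (INR n.+1 * y) = - y + - (INR n * y) by rewrite S_INR; rlra.
rewrite exp_plus /=; apply: Rmult_le_compat => //; exact: pow_le.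
Qed.

(** With [e = exp (- (D / 24))] the left side is at most [e * e + 24 * (e * e)], because
    [D * exp (- (D / 12)) <= 12]; and [25 * e <= 1] since [576 = 24 * 24]. *)
Lemma two_exponentials_le D : 576 <= D ->
  exp (- (D * (1 / 2))) + D * (2 * exp (- (D * (1 / 6)))) <= exp (- (D / 24)).
Proof.
move=> D0; set e := exp (- (D / 24)).
have e0 : 0 < e by apply: exp_pos.
have e1 : e * exp (D / 24) = 1 by rewrite /e -exp_plus Rplus_opp_l exp_0.
have e25 : 25 * e <= 1.
  have e24 : 25 <= exp (D / 24) by have := exp_ineq1_le (D / 24); rlra.
  by rnra.
have E2 : exp (- (D / 12)) = e * e by rewrite /e -exp_plus; f_equal; field.
have E6 : exp (- (D * (1 / 6))) = exp (- (D / 12)) * (e * e).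
  by rewrite -E2 -exp_plus; f_equal; field.
have D12 : D * exp (- (D / 12)) <= 12.
  have : exp (D / 12) * exp (- (D / 12)) = 1 by rewrite -exp_plus Rplus_opp_r exp_0.
  have := exp_ineq1_le (D / 12); have := exp_pos (- (D / 12)); rnra.
have le2 : exp (- (D * (1 / 2))) <= e * e.
  rewrite -E2; have [/exp_increasing|->] : - (D * (1 / 2)) <= - (D / 12) by rlra.
    by rlra.
  by rlra.
rewrite E6; have : D * (2 * (exp (- (D / 12)) * (e * e))) <= 24 * (e * e).
  have ee : 0 < e * e by rnra.
  by rnra.
by rnra.
Qed.

Lemma ln_mul_le c eps : 0 < c -> 0 < eps ->
  exists T, 1 <= T /\ forall t, T <= t -> ln (c * t) <= eps * t.
Proof.
move=> c0 e0; exists (Rmax 1 ((ln c - ln (eps / 2)) / (eps / 2))); split; first exact: Rmax_l.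
move=> t Tt; have t1 : 1 <= t by apply: Rle_trans Tt; apply: Rmax_l.
have e2 : 0 < eps / 2 by rlra.
have : (ln c - ln (eps / 2)) / (eps / 2) <= t by apply: Rle_trans Tt; apply: Rmax_r.
move=> /(Rmult_le_compat_r (eps / 2) _ _ (Rlt_le _ _ e2)).
have -> : (ln c - ln (eps / 2)) / (eps / 2) * (eps / 2) = ln c - ln (eps / 2) by field; rlra.
move=> le1.
have le2 : ln (eps / 2 * t) <= eps / 2 * t.
  have p : 0 < eps / 2 * t by rnra.
  have := exp_ineq1_le (ln (eps / 2 * t)); rewrite exp_ln //; rlra.
rewrite ln_mult // in le2; last by rlra.
by rewrite ln_mult //; rlra.
Qed.

Section Main.
Variables (d : nat -> nat) (F : finGroupType) (Hs : seq (Hel d)) (B : nat).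
Notation ST := ({perm 'I_(d 0)} * 'I_(size Hs) * F * {perm 'I_(d 0)})%type.
Hypothesis d2 : forall j, (2 <= d j)%nat.
Hypothesis dB : forall j, (d j <= B)%nat.
Hypothesis F1 : (1 < #|F|)%nat.
Hypothesis Hnd : List.NoDup Hs.
Hypothesis Hid : List.In (@idH d) Hs.
Hypothesis Hmul : forall h1 h2, List.In h1 Hs -> List.In h2 Hs -> List.In (mulH h1 h2) Hs.
Hypothesis Huni : forall m (t : 'I_(d m)), val t != 0%nat -> forall sigma : {perm 'I_(d m.+1)},
  (count (fun h : Hel d => h m t == sigma) Hs * (d m.+1)`! = size Hs)%nat.

Let vol k := (\prod_(i < k) d i)%nat.

Lemma vol_gt0 k : (0 < vol k)%nat.
Proof. exact: prod_d_gt0. Qed.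

Lemma vol_ge k : (expn 2 k <= vol k)%nat.
Proof.
have -> : (expn 2 k = \prod_(i < k) 2)%nat by rewrite prod_nat_const card_ord.
exact: leq_prod.
Qed.

(** The assumption on [n] forces [9 <= lfun d n], hence at least [2 ^ 10 >= 576] vertices.
    Nontriviality of [F] enters as [1 / #|F| <= 1 - 1 / 2]. *)
Lemma retprob_le_exp n : (expn B (3 * 10) <= n)%nat ->
  retprob F Hs n <= exp (- (INR (vol (lfun d n).+1) / 24)).
Proof.
move=> Bn; have [l9 lc] := lcond_lfun d2 dB Bn; set l := lfun d n in l9 lc *.
set D := vol l.+1; have D576 : 576 <= INR D.
  have -> : 576 = INR 576 by rewrite INR_IZR_INZ.
  apply: INR_leq; apply: leq_trans (vol_ge _).
  by apply: (@leq_trans (expn 2 10)) => //; rewrite leq_exp2l.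
have Dn : INR D <= INR n * rate_prod R d l.+1 0 by have /RleP := rate_prod_lcond d2 lc; rewrite !INRE.
have p0 : 0 < rate_prod R d l.+1 0 by apply/RltP/rate_prod_gt0.
have p1 : rate_prod R d l.+1 0 <= 1 by apply/RleP/rate_prod_le1.
have : retprob F Hs n <= (/ INR #|F|) ^ D + INR D * (INR 2 * (1 - rate_prod R d l.+1 0 / INR 6) ^ n).
  by rewrite !RpowE !INRE; apply/RleP/retprob_le.
move: (rate_prod R d l.+1 0) p0 p1 Dn => p p0 p1 Dn le1.
apply: Rle_trans le1 _; apply: Rle_trans (two_exponentials_le D576).
have F2 : 2 <= INR #|F| by apply: (INR_leq F1).
have Fi : / INR #|F| <= 1 / 2.
  by rewrite /Rdiv Rmult_1_l; apply: Rinv_le_contravar; rlra.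
have Fi0 : 0 <= / INR #|F| by left; apply: Rinv_0_lt_compat; rlra.
apply: Rplus_le_compat; first by apply: pow_le_exp; rlra.
have -> : INR 6 = 6 by rewrite INR_IZR_INZ.
apply: Rmult_le_compat_l; first exact: pos_INR.
apply: Rmult_le_compat_l; first by rewrite /=; rlra.
have p01 : 0 < p <= 1 by split.
apply: Rle_trans (pow_le_exp n (y := p / 6) _ _) _; try by rlra.
have [/exp_increasing|->] : - (INR n * (p / 6)) <= - (INR D * (1 / 6)) by rlra.
  by rlra.
by rlra.
Qed.

Lemma retprob_gt0 n : 0 < retprob F Hs n.
Proof.
have : kcond d n (kfun d n) by apply: kcond_kfun.
move=> /(rate_prod_kcond d2) /(@retprob_ge _ F Hs d2 Hnd Hid Hmul Huni) /RleP; apply: Rlt_le_trans.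
apply/RltP; rewrite mulr_gt0 ?exprn_gt0 ?invr_gt0 ?mulr_gt0 ?ltr0n ?ST_gt0 //.
by apply/card_gt0P; exists (enc d2 (kfun d n) [::]).
Qed.

(** Bounds the size of the alphabet of the stream, uniformly in the level. *)
Let A := (size Hs * #|F| * B`!)%nat.+1.
Let c1 := 2 * ln 2 + 18 * ln (INR A) + 2 * ln (INR B`!) + ln (INR #|{: ST}|).

Lemma ln_card_enc_le m : 
  ln (INR #|enc_type F Hs m|) <=
  INR (vol m.+1) * (9 * ln (INR A) + ln (INR B`!) + ln (INR (vol m.+1))).
Proof.
rewrite card_enc card_vertex -/(vol m.+1); set D := vol m.+1.
have D0 : (0 < D)%nat by apply: vol_gt0.
have fB : ((d m.+1)`! <= B`!)%nat by apply: leq_fact.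
apply: (@Rle_trans _ (ln (INR (expn A (9 * D) * expn B`! D * expn D D)%nat))).
  apply: ln_le; first by apply: INR_pos; rewrite !muln_gt0 !expn_gt0 fact_gt0 D0.
  apply: INR_leq; rewrite leq_mul // leq_mul // leq_exp2r ?muln_gt0 //.
  by rewrite ltnS leq_mul.
have A0 : (0 < A)%nat by [].
have B0 := fact_gt0 B.
have e1 : 0 < INR (expn A (9 * D)) by apply: INR_pos; rewrite expn_gt0.
have e2 : 0 < INR (expn B`! D) by apply: INR_pos; rewrite expn_gt0 B0.
have e3 : 0 < INR (expn D D) by apply: INR_pos; rewrite expn_gt0 D0.
rewrite !INRM ln_mult ?ln_mult ?ln_INR_exp //; last exact: Rmult_lt_0_compat.
rewrite INRM (_ : INR 9 = 9); last by rewrite INR_IZR_INZ.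
by right; ring.
Qed.

Lemma neg_ln_retprob_le n : 
  let D := INR (vol (kfun d n).+1) in
  - ln (retprob F Hs n) <= D * (c1 + 2 * ln D).
Proof.
set m := kfun d n => D.
have D1 : 1 <= D by apply: (INR_leq (vol_gt0 _)).
have E0 : 0 < INR #|enc_type F Hs m|.
  by apply: INR_pos; apply/card_gt0P; exists (enc d2 m [::]).
have S0 : 0 < INR #|{: ST}| by apply/INR_pos/ST_gt0.
have S1 : 1 <= INR #|{: ST}| by apply: (INR_leq (ST_gt0 F Hid)).
have : / INR #|{: ST}| * (/ (INR 2 * INR #|enc_type F Hs m|)) ^ 2 <= retprob F Hs n.
  rewrite !RpowE !INRE; apply/RleP/retprob_ge => //.
  by apply: rate_prod_kcond => //; apply: kcond_kfun.
have i0 : 0 < / INR #|{: ST}| by apply: Rinv_0_lt_compat.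
have -> : INR 2 = 2 by rewrite INR_IZR_INZ.
have j0 : 0 < / (2 * INR #|enc_type F Hs m|) by apply: Rinv_0_lt_compat; rlra.
rewrite [_ ^ 2]/= Rmult_1_r.
have jj0 := Rmult_lt_0_compat _ _ j0 j0.
move=> /(ln_le (Rmult_lt_0_compat _ _ i0 jj0)).
have -> := ln_mult _ _ i0 jj0; have -> := ln_mult _ _ j0 j0.
rewrite (ln_Rinv _ S0) (ln_Rinv (2 * _)); last by rlra.
rewrite (ln_mult 2 _ _ E0); last by rlra.
have := ln_card_enc_le m; rewrite -/D.
have := ln_ge0 S1; have l2 : 0 <= ln 2 by apply: ln_ge0; rlra.
rewrite /c1; rnra.
Qed.

Lemma ln_INR_large T : exists N, forall n, (N <= n)%nat -> T <= ln (INR n) /\ (N <= n)%nat.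
Proof.
have [N0 HN] := INR_unbounded (exp T).
exists N0 => n Nn; split=> //; rewrite -(ln_exp T); apply: ln_le; first exact: exp_pos.
by apply: Rle_trans (INR_leq Nn); rlra.
Qed.

(** The constant 24 costs only [ln 24 / ln n]. Positivity of [- ln (retprob F Hs n)] is recorded
    because monotonicity of the outer logarithm in [le_beta] rests on it. *)
Lemma beta'_le eps : 0 < eps -> exists N, forall n, (N <= n)%nat ->
  0 < - ln (retprob F Hs n) /\ beta' d n - eps <= ln (- ln (retprob F Hs n)) / ln (INR n).
Proof.
move=> e0; have [N HN] := ln_INR_large (Rmax 1 (ln 24 / eps)).
exists (maxn N (expn B (3 * 10))) => n; rewrite geq_max => /andP[/HN[lnn _] Bn].
have t1 : 1 <= ln (INR n) by apply: Rle_trans lnn; apply: Rmax_l.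
have t2 : ln 24 / eps <= ln (INR n) by apply: Rle_trans lnn; apply: Rmax_r.
have le1 := retprob_le_exp Bn; have P0 := retprob_gt0 n.
rewrite /beta' -/(vol _); set D := INR (vol _) in le1 *.
have D0 : 0 < D by apply/INR_pos/vol_gt0.
have lnP : D / 24 <= - ln (retprob F Hs n).
  by have := ln_le P0 le1; rewrite ln_exp; rlra.
split; first by rlra.
have lnD : ln D - ln 24 <= ln (- ln (retprob F Hs n)).
  have <- : ln (D / 24) = ln D - ln 24 by rewrite /Rdiv ln_mult ?ln_Rinv; rlra.
  by apply: ln_le; rlra.
have le24 : ln 24 <= eps * ln (INR n).
  have := Rmult_le_compat_l eps _ _ (Rlt_le _ _ e0) t2.
  by have -> : eps * (ln 24 / eps) = ln 24; [field; rlra|].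
have -> : ln D / ln (INR n) - eps = (ln D - eps * ln (INR n)) / ln (INR n) by field; rlra.
by apply: Rmult_le_compat_r; [left; apply: Rinv_0_lt_compat; rlra|rlra].
Qed.

Lemma le_beta eps : 0 < eps -> exists N, forall n, (N <= n)%nat ->
  0 < - ln (retprob F Hs n) -> ln (- ln (retprob F Hs n)) / ln (INR n) <= beta d n + eps.
Proof.
move=> e0; have B1 : 1 <= INR B by apply: (@INR_leq 1); apply: leq_trans (dB 0%nat); apply: ltnW (d2 0%nat).
have lnB : 0 <= ln (INR B) by apply: ln_ge0.
have l2 : 0 <= ln 2 by apply: ln_ge0; rlra.
have lS : 0 <= ln (INR #|{: ST}|) by apply/ln_ge0/(INR_leq (ST_gt0 F Hid)).
have lA : 0 <= ln (INR A) by apply/ln_ge0/(@INR_leq 1).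
have lB : 0 <= ln (INR B`!) by apply/ln_ge0/(INR_leq (fact_gt0 B)).
have c10 : 0 <= c1 by rewrite /c1; rlra.
have c0 : 0 < c1 + 2 * ln (INR B) + 2 by rlra.
have [T [T1 HT]] := ln_mul_le c0 e0; have [N HN] := ln_INR_large T.
exists (maxn N 1) => n; rewrite geq_max => /andP[/HN[lnn _] n0] P0.
set t := ln (INR n) in lnn *; have t1 : 1 <= t by rlra.
have n0' : 0 < INR n by apply: INR_pos.
have le1 := neg_ln_retprob_le n; rewrite /beta -/(vol _).
set D := INR (vol _) in le1 *.
have D1 : 1 <= D by apply: (INR_leq (vol_gt0 _)).
have lnD : ln D <= ln (INR B) + t.
  rewrite /t -ln_mult //; last by rlra.
  by apply: ln_le; [rlra|rewrite -INRM; apply: INR_leq; apply: prod_kfun_le].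
(* Since [D] is at most [B * n], its logarithm is at most [ln B + t]; the factor beside [D] is then
   linear in [t], and its logarithm is absorbed by [eps * t]. *)
have le2 : - ln (retprob F Hs n) <= D * ((c1 + 2 * ln (INR B) + 2) * t).
  apply: Rle_trans le1 _; apply: Rmult_le_compat_l; first by rlra.
  have : (c1 + 2 * ln (INR B)) * 1 <= (c1 + 2 * ln (INR B)) * t.
    by apply: Rmult_le_compat_l; rlra.
  by rlra.
have lnle : ln (- ln (retprob F Hs n)) <= ln D + eps * t.
  apply: Rle_trans (ln_le P0 le2) _; rewrite ln_mult; [|rlra|by apply: Rmult_lt_0_compat; rlra].
  by have := HT t lnn; rlra.
have -> : ln D / t + eps = (ln D + eps * t) / t by field; rlra.
by apply: Rmult_le_compat_r => //; left; apply: Rinv_0_lt_compat; rlra.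
Qed.
End Main.

End Analysis.

Theorem mainTheorem12 (d : nat -> nat) (F : finGroupType) (Hs : seq (Hel d)) :
  (forall j, 2 <= d j) ->
  (exists D, forall j, d j <= D) ->
  1 < #|F| ->
  (* H is a finite subgroup of H_d, listed without repetition *)
  List.NoDup Hs ->
  (forall h, List.In h Hs -> forall m (t : 'I_(d m)), val t = 0 -> h m t = 1%g) ->
  List.In (@idH d) Hs ->
  (forall h1 h2, List.In h1 Hs -> List.In h2 Hs -> List.In (mulH h1 h2) Hs) ->
  (* the uniform measure on H pushes forward to the uniform measure on each factor *)
  (forall m (t : 'I_(d m)), val t != 0 -> forall sigma : {perm 'I_(d m.+1)},
      count (fun h : Hel d => h m t == sigma) Hs * (d m.+1)`! = size Hs) ->
  forall eps : R, (0 < eps)%R ->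
  exists N : nat, forall n : nat, N <= n ->
    (beta' d n - eps <= ln (- ln (@retprob d F Hs n)) / ln (INR n) <= beta d n + eps)%R.
Proof.
move=> d2 [B dB] F1 Hnd _ Hid Hmul Huni eps e0.
have [N1 H1] := beta'_le d2 dB F1 Hnd Hid Hmul Huni e0.
have [N2 H2] := le_beta F d2 dB Hnd Hid Hmul Huni e0.
exists (maxn N1 N2) => n; rewrite geq_max => /andP[/H1[P0 le1] /H2/(_ P0) le2].
by split.
Qed.
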